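(* Let $k$ be an algebraically closed field and let $\mathcal{A}$ be a connected finite directed category over $k$ with respect to a linear order $\leqslant$ on $\mathrm{Ob}\,\mathcal{A}$, such that every object of $\mathcal{A}$ is primitive. Suppose that $\mathcal{A}$ is standardly stratified with respect to $\leqslant$. Then: (1) $\mathcal{F}_{\mathcal{A}}(\Delta)$ is closed under cokernels of monomorphisms. (2) $\mathcal{F}_{\mathcal{A}}(\Delta) = \mathcal{P}^f(\mathcal{A})$. (3) A finitely generated $\mathcal{A}$-module $M$ has finite projective dimension if and only if for every $x \in \mathrm{Ob}\,\mathcal{A}$, $M(x)$ is a free $\mathcal{A}(x,x)$-module.
   Context: A finite directed category (with respect to a linear order $\leqslant$ on $\mathrm{Ob}\,\mathcal{A}$) is a $k$-linear category $\mathcal{A}$ with finitely many objects and finite-dimensional morphism spaces such that $\mathcal{A}(x,y)\neq 0$ implies $x\leqslant y$. It is connected if any two objects are joined by a finite sequence of objects in which, for each consecutive pair, there is a nonzero morphism in at least one direction. An object $x$ is primitive if $\mathcal{A}(x,x)$ is a local algebra. The associated algebra $A$ is the direct sum of all morphism spaces, with multiplication given by composition (from right to left) whenever defined and zero otherwise; $1_x\in A$ is the identity morphism of $x$, and $\mathcal{A}(x,y)=1_yA1_x$. $\mathcal{A}$-modules are finitely generated left $A$-modules, equivalently $k$-linear covariant functors from $\mathcal{A}$ to finite-dimensional vector spaces; the value of $M$ on $x$ is $M(x)=1_xM$. The zero module is regarded as free. Since all objects are primitive, the indecomposable projective modules are $P_x=\mathcal{A}1_x$, $x\in\mathrm{Ob}\,\mathcal{A}$,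 with tops $S_x$. The standard module $\Delta_x$ is the largest quotient of $P_x$ all of whose composition factors $S_y$ satisfy $y\leqslant x$. $\mathcal{F}_{\mathcal{A}}(\Delta)$ is the full subcategory of $\mathcal{A}$-modules having a finite filtration with all successive quotients isomorphic to standard modules. $\mathcal{A}$ is standardly stratified with respect to $\leqslant$ if ${}_AA\in\mathcal{F}_{\mathcal{A}}(\Delta)$. $\mathcal{P}^f(\mathcal{A})$ is the full subcategory of finitely generated $\mathcal{A}$-modules of finite projective dimension. ''Closed under cokernels of monomorphisms'' means: if $0\to L\to M\to N\to 0$ is exact with $L,M\in\mathcal{F}_{\mathcal{A}}(\Delta)$, then $N\in\mathcal{F}_{\mathcal{A}}(\Delta)$. *)

(* Defs.v *)
From HB Require Import structures.
From mathcomp Require Import all_boot all_order all_algebra.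

Set Implicit Arguments.
Unset Strict Implicit.
Unset Printing Implicit Defensive.

Import Order.TTheory GRing.Theory.
Local Open Scope ring_scope.

(* A k-linear category with object set Ob and finite-dimensional morphism
   spaces. Composition goes from right to left, and its k-bilinearity is
   carried by the type of [comp]. *)
Record lcat (k : fieldType) (Ob : Type) := LCat {
  mor :> Ob -> Ob -> vectType k;
  idm : forall x, mor x x;
  comp : forall x y z, 'Hom(mor y z, 'Hom(mor x y, mor x z));
  comp1m : forall x y (f : mor x y), comp x y y (idm y) f = f;
  compm1 : forall x y (f : mor x y), comp x x y f (idm x) = f;
  compmA : forall w x y z (h : mor y z) (g : mor x y) (f : mor w x),
    comp w y z h (comp w x y g f) = comp w x z (comp x y z h g) f }.

Arguments idm {k Ob} l x.
Arguments comp {k Ob} l {x y z}.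

(* Finite-dimensional modules, as k-linear covariant functors. *)
Record lmodule (k : fieldType) (Ob : Type) (A : lcat k Ob) := LModule {
  fiber :> Ob -> vectType k;
  act : forall x y, 'Hom(A x y, 'Hom(fiber x, fiber y));
  act1 : forall x, act x x (idm A x) = \1%VF;
  actM : forall x y z (g : A y z) (f : A x y),
    act x z (comp A g f) = (act y z g \o act x y f)%VF }.

Arguments act {k Ob A} l {x y}.

Section Modules.
Context {k : fieldType} {Ob : Type} {A : lcat k Ob}.
Implicit Types M N L D S P : lmodule A.

Record lhom M N := LHom {
  lhom_fun :> forall x, 'Hom(M x, N x);
  lhom_nat : forall x y (f : A x y),
    (lhom_fun y \o act M f = act N f \o lhom_fun x)%VF }.

Definition lmono M N (f : lhom M N) := forall x, lker (f x) = 0%VS.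
Definition lepi M N (f : lhom M N) := forall x, limg (f x) = fullv.
Definition lexact L M N (f : lhom L M) (g : lhom M N) :=
  forall x, limg (f x) = lker (g x).

Record lsub M := LSub {
  lsub_space :> forall x, {vspace M x};
  lsub_stable : forall x y (f : A x y),
    (act M f @: lsub_space x <= lsub_space y)%VS }.

Definition lsub_le M (U V : lsub M) := forall x, (U x <= V x)%VS.
Definition lsub_zero M (U : lsub M) := forall x, U x = 0%VS.
Definition lsub_full M (U : lsub M) := forall x, U x = fullv.

Section SubModule.
Variables (M : lmodule A) (U : lsub M).

Definition lsubm_act0 x y (f : A x y) (u : subvs_of (U x)) : subvs_of (U y) :=
  vsproj (U y) (act M f (vsval u)).

Fact lsubm_act0_linear x y f : linear (@lsubm_act0 x y f).
Proof. by move=> a u v; rewrite /lsubm_act0 !linearP. Qed.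
HB.instance Definition _ x y f :=
  GRing.isSemilinear.Build k _ _ _ (@lsubm_act0 x y f)
    (GRing.semilinear_linear (lsubm_act0_linear f)).

Definition lsubm_act1 x y (f : A x y) := linfun (lsubm_act0 f).

Fact lsubm_act1_linear x y : linear (@lsubm_act1 x y).
Proof.
move=> a f g; apply/lfunP=> u; rewrite add_lfunE scale_lfunE !lfunE /=.
by rewrite /lsubm_act0 linearP add_lfunE scale_lfunE linearP.
Qed.
HB.instance Definition _ x y :=
  GRing.isSemilinear.Build k _ _ _ (@lsubm_act1 x y)
    (GRing.semilinear_linear (@lsubm_act1_linear x y)).

Definition lsubm_act x y := linfun (@lsubm_act1 x y).

Fact lsubm_actE x y (f : A x y) u : vsval (lsubm_act x y f u) = act M f (vsval u).
Proof.
rewrite /lsubm_act lfunE /= /lsubm_act1 lfunE /= /lsubm_act0 vsprojK //.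
by apply: (subvP (lsub_stable U f)); rewrite memv_img ?subvsP.
Qed.

Fact lsubm_act_id x : lsubm_act x x (idm A x) = \1%VF.
Proof.
by apply/lfunP=> u; apply: val_inj; rewrite [LHS]lsubm_actE act1 !id_lfunE.
Qed.

Fact lsubm_act_comp x y z (g : A y z) (f : A x y) :
  lsubm_act x z (comp A g f) = (lsubm_act y z g \o lsubm_act x y f)%VF.
Proof.
apply/lfunP=> u; apply: val_inj; rewrite comp_lfunE.
by rewrite [LHS]lsubm_actE [RHS]lsubm_actE lsubm_actE actM comp_lfunE.
Qed.

Definition lsubm : lmodule A := LModule lsubm_act_id lsubm_act_comp.

End SubModule.

(* D is isomorphic to the quotient V / U, for submodules U <= V of M. *)
Definition is_quot M (V U : lsub M) D :=
  exists p : lhom (lsubm V) D, lepi p /\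
    forall x (v : subvs_of (V x)), (v \in lker (p x)) = (vsval v \in U x).

Definition is_filtration M n (F : nat -> lsub M) :=
  [/\ lsub_zero (F 0%N), lsub_full (F n)
    & forall i, (i < n)%N -> lsub_le (F i) (F i.+1)].

Definition filtered_by (X : lmodule A -> Prop) M :=
  exists n (F : nat -> lsub M), is_filtration n F /\
    forall i, (i < n)%N -> exists2 D, X D & is_quot (F i.+1) (F i) D.

Definition lsimple S :=
  (exists x, fullv != 0%VS :> {vspace S x}) /\
  forall U : lsub S, lsub_zero U \/ lsub_full U.

Definition comp_factor M S :=
  exists n (F : nat -> lsub M), [/\ is_filtration n F,
    forall i, (i < n)%N -> exists2 D, lsimple D & is_quot (F i.+1) (F i) D
    & exists2 i, (i < n)%N & is_quot (F i.+1) (F i) S].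

Definition maximal_lsub M (U : lsub M) :=
  ~ lsub_full U /\
  forall V : lsub M, lsub_le U V -> lsub_le V U \/ lsub_full V.

(* S is isomorphic to M / rad M, the radical being the intersection of the
   maximal submodules. *)
Definition is_top M S :=
  exists p : lhom M S, lepi p /\
    forall x (v : M x), v \in lker (p x) <->
      forall U : lsub M, maximal_lsub U -> v \in U x.

Definition lprojective P :=
  forall M N (p : lhom M N) (f : lhom P N), lepi p ->
    exists g : lhom P M, forall x, (p x \o g x)%VF = f x.

(* Existence of a resolution 0 -> Q n -> ... -> Q 0 -> M -> 0 by finitely
   generated projective modules. *)
Definition finite_projdim M :=
  exists n (Q : nat -> lmodule A) (d : forall i, lhom (Q i.+1) (Q i))
      (e : lhom (Q 0%N) M),
    [/\ forall i, lprojective (Q i),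
        forall i, (n < i)%N -> forall x, fullv = 0%VS :> {vspace Q i x},
        lepi e, lexact (d 0%N) e
      & forall i, lexact (d i.+1) (d i)].

(* M x is free over the algebra A x x: it has a finite, possibly empty, basis. *)
Definition free_at M x :=
  exists n (e : 'I_n -> M x), forall m : M x,
    exists! a : {ffun 'I_n -> A x x}, m = \sum_(i < n) act M (a i) (e i).

Fact lzero_actM (x y z : Ob) (g : A y z) (f : A x y) :
  (0 : 'Hom(A x z, 'Hom('rV[k]_0, 'rV[k]_0))) (comp A g f) =
  ((0 : 'Hom(A y z, 'Hom('rV[k]_0, 'rV[k]_0))) g \o
   (0 : 'Hom(A x y, 'Hom('rV[k]_0, 'rV[k]_0))) f)%VF.
Proof. by apply/lfunP=> u; rewrite [LHS]thinmx0 [RHS]thinmx0. Qed.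

Fact lzero_act1 (x : Ob) :
  (0 : 'Hom(A x x, 'Hom('rV[k]_0, 'rV[k]_0))) (idm A x) = \1%VF.
Proof. by apply/lfunP=> u; rewrite [LHS]thinmx0 [RHS]thinmx0. Qed.

Definition lzero : lmodule A :=
  @LModule k Ob A (fun=> 'rV[k]_0) (fun _ _ => 0) lzero_act1 lzero_actM.

Section DirectSum.
Variables M N : lmodule A.

Definition lsum_act0 x y (f : A x y) (u : M x * N x) : M y * N y :=
  (act M f u.1, act N f u.2).

Fact lsum_act0_linear x y f : linear (@lsum_act0 x y f).
Proof. by move=> a u v; rewrite /lsum_act0 /= !linearP. Qed.
HB.instance Definition _ x y f :=
  GRing.isSemilinear.Build k _ _ _ (@lsum_act0 x y f)
    (GRing.semilinear_linear (lsum_act0_linear f)).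

Definition lsum_act1 x y (f : A x y) := linfun (lsum_act0 f).

Fact lsum_act1_linear x y : linear (@lsum_act1 x y).
Proof.
move=> a f g; apply/lfunP=> u; rewrite add_lfunE scale_lfunE !lfunE /=.
by rewrite /lsum_act0 !linearP !add_lfunE !scale_lfunE.
Qed.
HB.instance Definition _ x y :=
  GRing.isSemilinear.Build k _ _ _ (@lsum_act1 x y)
    (GRing.semilinear_linear (@lsum_act1_linear x y)).

Definition lsum_act x y := linfun (@lsum_act1 x y).

Fact lsum_actE x y (f : A x y) u :
  lsum_act x y f u = (act M f u.1, act N f u.2).
Proof. by rewrite /lsum_act lfunE /= /lsum_act1 lfunE. Qed.

Fact lsum_act_id x : lsum_act x x (idm A x) = \1%VF.
Proof.
by apply/lfunP=> u; rewrite lsum_actE !act1 !id_lfunE; case: u.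
Qed.

Fact lsum_act_comp x y z (g : A y z) (f : A x y) :
  lsum_act x z (comp A g f) = (lsum_act y z g \o lsum_act x y f)%VF.
Proof.
by apply/lfunP=> u; rewrite comp_lfunE !lsum_actE /= !actM !comp_lfunE.
Qed.

Definition lsum : lmodule A := LModule lsum_act_id lsum_act_comp.

End DirectSum.

Fact lproj_act1 x y : comp A (idm A y) = \1%VF :> 'Hom(A x y, A x y).
Proof. by apply/lfunP=> f; rewrite id_lfunE comp1m. Qed.

Fact lproj_actM w x y z (g : A y z) (f : A x y) :
  comp A (comp A g f) = (comp A g \o comp A f)%VF :> 'Hom(A w x, A w z).
Proof. by apply/lfunP=> h; rewrite comp_lfunE compmA. Qed.

(* P_x = A 1_x, that is, the representable functor A(x, -). *)
Definition lproj (x : Ob) : lmodule A :=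
  @LModule k Ob A (A x) (fun y z => @comp k Ob A x y z)
    (@lproj_act1 x) (@lproj_actM x).

Definition left_ideal x (I : {vspace A x x}) :=
  forall a b : A x x, b \in I -> comp A a b \in I.

Definition maximal_left_ideal x (I : {vspace A x x}) :=
  [/\ left_ideal I, I != fullv
    & forall J, left_ideal J -> (I <= J)%VS -> J = I \/ J = fullv].

(* The endomorphism algebra A x x is local. *)
Definition primitive (x : Ob) := exists! I : {vspace A x x}, maximal_left_ideal I.

End Modules.

Arguments lproj {k Ob} A x.
Arguments primitive {k Ob} A x.

Section Directed.
Context {k : fieldType} {disp : Order.disp_t} {Ob : finOrderType disp}.
Variable A : lcat k Ob.
Implicit Types M N L D S P Q : lmodule A.

Definition mor_nonzero (x y : Ob) := (fullv : {vspace A x y}) != 0%VS.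

Definition directed := forall x y, mor_nonzero x y -> (x <= y)%O.

Definition connected :=
  forall x y, connect (fun a b => mor_nonzero a b || mor_nonzero b a) x y.

(* Every composition factor of M of the form S_y = top P_y has y <= x. *)
Definition factors_le (x : Ob) M :=
  forall y S, is_top (lproj A y) S -> comp_factor M S -> (y <= x)%O.

(* D is isomorphic to Delta_x: it is a quotient of P_x with [factors_le x D],
   and every quotient of P_x with this property is a quotient of D,
   compatibly with the projections. *)
Definition is_standard (x : Ob) D :=
  exists p : lhom (lproj A x) D,
    [/\ lepi p, factors_le x D
      & forall Q (q : lhom (lproj A x) Q), lepi q -> factors_le x Q ->
          exists h : lhom D Q, forall y, (h y \o p y)%VF = q y].

Definition F_Delta M := filtered_by (fun D => exists x, is_standard x D) M.

(* The left module A over the associated algebra, decomposed as the direct sum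
   of the A 1_x. *)
Definition regular : lmodule A := \big[@lsum k Ob A/lzero]_(x : Ob) lproj A x.

Definition standardly_stratified := F_Delta regular.

Definition closed_under_cokernels (X : lmodule A -> Prop) :=
  forall L M N (f : lhom L M) (g : lhom M N),
    lmono f -> lexact f g -> lepi g -> X L -> X M -> X N.

End Directed.

(* Main.v *)
(* Directedness concentrates Delta_x at x, where it is A(x,x); hence F(Delta)
   consists of the modules with free fibres: if x is minimal in the support of
   such a module, dropping a basis vector at x leaves a submodule with quotient
   Delta_x. Each A(x,x) is local of finite dimension with radical J, so sJ = 0
   for some s <> 0, and multiplication by s on a free module has kernel exactly
   J times the module; hence an injection of free modules stays injective modulo
   J and has a free cokernel. This gives closure under cokernels and, along a
   finite projective resolution, free fibres, because stratification makes the
   fibres of the projectives free. Conversely, a module with free fibres whose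
   support has least object x is the image of a projective that agrees with it
   at x; the kernel has free fibres and is supported above x, so iterating
   terminates. *)

From HB Require Import structures.
From Stdlib Require Import Classical.
From mathcomp Require Import all_boot all_order all_algebra.
From mathcomp Require Import zify.
Require Import Defs.

Set Implicit Arguments.
Unset Strict Implicit.
Unset Printing Implicit Defensive.

Import Order.TTheory GRing.Theory.
Local Open Scope ring_scope.

(** Without a maximum every value could be exceeded, and the measure would pass the bound [b].
    Below, the measure is a dimension. *)
Lemma ex_maxmeasure (T : Type) (P : T -> Prop) (m : T -> nat) (b : nat)
    (t0 : T) :
  P t0 -> (forall t, P t -> (m t <= b)%N) ->
  exists t, P t /\ forall t', P t' -> (m t' <= m t)%N.
Proof.
move=> Pt0 mb; apply: NNPP => noM.
have big n : exists t, P t /\ (n <= m t)%N.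
  elim: n => [|n [t [Pt nt]]]; first by exists t0.
  apply: NNPP => no; apply: noM; exists t; split=> // t' Pt'.
  rewrite leqNgt; apply/negP => lt; apply: no; exists t'; split=> //.
  exact: leq_ltn_trans lt.
have [t [Pt lt]] := big b.+1.
by have := mb t Pt; rewrite leqNgt lt.
Qed.

(** * Elementwise rules for actions and morphisms *)

Section ModuleElements.
Context {k : fieldType} {Ob : Type} {A : lcat k Ob}.
Implicit Types M N : lmodule A.

Lemma actDl M x y (f g : A x y) (m : M x) : act M (f + g) m = act M f m + act M g m.
Proof. by rewrite linearD add_lfunE. Qed.

Lemma actZl M x y c (f : A x y) (m : M x) : act M (c *: f) m = c *: act M f m.
Proof. by rewrite linearZ scale_lfunE. Qed.

Lemma act0l M x y (m : M x) : act M (0 : A x y) m = 0.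
Proof. by rewrite linear0 zero_lfunE. Qed.

Lemma act_suml M x y I (r : seq I) (P : pred I) (F : I -> A x y) (m : M x) :
  act M (\sum_(i <- r | P i) F i) m = \sum_(i <- r | P i) act M (F i) m.
Proof. by rewrite linear_sum sum_lfunE. Qed.

Lemma act_idE M x (m : M x) : act M (idm A x) m = m.
Proof. by rewrite act1 id_lfunE. Qed.

Lemma act_compE M x y z (g : A y z) (f : A x y) (m : M x) :
  act M (comp A g f) m = act M g (act M f m).
Proof. by rewrite actM comp_lfunE. Qed.

Lemma lhom_natE M N (p : lhom M N) x y (f : A x y) (m : M x) :
  p y (act M f m) = act N f (p x m).
Proof. by have /lfunP/(_ m) := lhom_nat p f; rewrite !comp_lfunE. Qed.

Lemma compA x y z w (h : A z w) (g : A y z) (f : A x y) :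
  comp A h (comp A g f) = comp A (comp A h g) f.
Proof. exact: compmA. Qed.

Lemma act_lproj x y z (f : A y z) (m : A x y) : act (lproj A x) f m = comp A f m.
Proof. by []. Qed.

Section Evaluation.
Variables (M : lmodule A) (x y : Ob) (m : M x).

Definition ev0 (f : A x y) : M y := act M f m.

Fact ev0_linear : linear ev0.
Proof. by move=> c f g; rewrite /ev0 actDl actZl. Qed.
HB.instance Definition _ :=
  GRing.isSemilinear.Build k _ _ _ ev0 (GRing.semilinear_linear ev0_linear).

(** On a representable module this is composition with [m] on the right, which is how right
    multiplications arise below. *)
Definition ev := linfun ev0.

Lemma evE f : ev f = act M f m. Proof. by rewrite lfunE. Qed.

End Evaluation.

End ModuleElements.

(** * Modules over a finite-dimensional local algebra *)

Section LocalAlgebra.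
Context {k : fieldType} {Ob : Type} {A : lcat k Ob} {x : Ob}.
Local Notation R := (A x x).
Local Notation "a ** b" := (comp A a b) (at level 40, left associativity).
Local Notation "1x" := (idm A x).
Implicit Types (M N : lmodule A) (J : {vspace R}).

(** Modules over the algebra [A x x] are not a separate type: they are the stable subspaces of
    fibres at [x], with [equivariant] maps as morphisms. *)
Definition stable M (U : {vspace M x}) :=
  forall a u, u \in U -> act M a u \in U.

Definition equivariant M N (g : 'Hom(M x, N x)) :=
  forall a m, g (act M a m) = act N a (g m).

Lemma stable_full M : stable (fullv : {vspace M x}).
Proof. by move=> a u _; apply: memvf. Qed.

Lemma stable_ker M N (g : 'Hom(M x, N x)) : equivariant g -> stable (lker g).
Proof. by move=> eg a u; rewrite !memv_ker eg => /eqP->; rewrite linear0. Qed.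

Lemma stable_img M N (g : 'Hom(M x, N x)) (U : {vspace M x}) :
  equivariant g -> stable U -> stable (g @: U)%VS.
Proof. by move=> eg sU a _ /memv_imgP[u uU ->]; rewrite -eg memv_img ?sU. Qed.

(** * Linear combinations and bases over the algebra at an object *)

Section Span.
Variables (M : lmodule A) (n : nat) (e : 'I_n -> M x).

(** The map from the free module of rank [n] that sends the standard basis to [e]. *)
Definition comb0 (a : {ffun 'I_n -> R}) : M x := \sum_(i < n) act M (a i) (e i).

Fact comb0_linear : linear comb0.
Proof.
move=> c a b; rewrite /comb0 scaler_sumr -big_split /=.
by apply: eq_bigr => i _; rewrite !ffunE actDl actZl.
Qed.
HB.instance Definition _ :=
  GRing.isSemilinear.Build k _ _ _ comb0 (GRing.semilinear_linear comb0_linear).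

Definition comb := linfun comb0.

Lemma combE a : comb a = \sum_(i < n) act M (a i) (e i).
Proof. by rewrite lfunE. Qed.

Lemma comb_act a b : act M a (comb b) = comb [ffun i => a ** b i].
Proof.
rewrite !combE linear_sum; apply: eq_bigr => i _.
by rewrite ffunE act_compE.
Qed.

Lemma stable_comb : stable (limg comb).
Proof. by move=> a _ /memv_imgP[b _ ->]; rewrite comb_act memv_img ?memvf. Qed.

Lemma memv_comb i : e i \in limg comb.
Proof.
have -> : e i = comb [ffun l => if l == i then 1x else 0].
  rewrite combE (bigD1 i) //= ffunE eqxx act_idE big1 ?addr0 // => l /negPf li.
  by rewrite ffunE li act0l.
exact: memv_img (memvf _).
Qed.

Lemma comb_sub (U : {vspace M x}) :
  stable U -> (forall i, e i \in U) -> (limg comb <= U)%VS.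
Proof.
move=> sU eU; apply/subvP => w /memv_imgP[a _ ->]; rewrite combE.
by apply: memv_suml => i _; apply: sU.
Qed.

Lemma dim_ffun_fullv (V : vectType k) :
  \dim {:{ffun 'I_n -> V}} = (n * \dim {:V})%N.
Proof. by rewrite !dimvf /dim /= card_ord. Qed.

End Span.

Definition basis_at M (U : {vspace M x}) n (e : 'I_n -> M x) :=
  lker (comb e) = 0%VS /\ limg (comb e) = U.

Lemma free_atP M : free_at M x <-> exists n (e : 'I_n -> M x), basis_at fullv e.
Proof.
split=> -[n [e he]]; exists n, e.
  split.
    apply/eqP/lker0P => a b ab; have [c [_ uc]] := he (comb e a).
    by rewrite -(uc a) ?combE // -(uc b) // ab combE.
  apply/eqP; rewrite eqEsubv subvf; apply/subvP => m _.
  have [c [-> _]] := he m; rewrite -(combE e) memv_img ?memvf //.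
have [/eqP/lker0P inj full] := he.
move=> m; have /memv_imgP[a _ ->]: m \in limg (comb e) by rewrite full memvf.
by exists a; split=> [|b]; rewrite ?combE // -!(combE e) => /inj.
Qed.

(** * The product of an ideal with a submodule *)

Section Radical.
Variable J : {vspace R}.

(** The subspace J U. By linearity a basis of J suffices, which makes it a finite sum of images. *)
Definition radm M (U : {vspace M x}) : {vspace M x} :=
  (\sum_(i < \dim J) act M (vbasis J)`_i @: U)%VS.

Lemma memv_radm M (U : {vspace M x}) j u :
  j \in J -> u \in U -> act M j u \in radm U.
Proof.
move=> jJ uU; rewrite (coord_vbasis jJ) act_suml; apply: memv_suml => i _.
rewrite actZl memvZ //; apply: subvP (memv_img _ uU).
exact: (sumv_sup i).
Qed.

Lemma radm_sub M (U W : {vspace M x}) :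
  (forall j u, j \in J -> u \in U -> act M j u \in W) -> (radm U <= W)%VS.
Proof.
move=> h; apply/subv_sumP => i _; apply/subvP => w /memv_imgP[u uU ->].
by apply: h => //; apply/vbasis_mem/mem_nth; rewrite size_tuple.
Qed.

Lemma radmS M (U : {vspace M x}) : stable U -> (radm U <= U)%VS.
Proof. by move=> sU; apply: radm_sub => j u _; apply: sU. Qed.

Lemma radm_img M N (g : 'Hom(M x, N x)) (U : {vspace M x}) :
  equivariant g -> (g @: radm U)%VS = radm (g @: U)%VS.
Proof.
move=> eg; apply/eqP; rewrite eqEsubv; apply/andP; split.
  rewrite limg_sum; apply/subv_sumP => i _; apply/subvP => w.
  move=> /memv_imgP[_ /memv_imgP[u uU ->] ->]; rewrite eg.
  apply: memv_radm; rewrite ?memv_img //; apply/vbasis_mem/mem_nth.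
  by rewrite size_tuple.
apply: radm_sub => j _ jJ /memv_imgP[u uU ->].
by rewrite -eg memv_img ?memv_radm.
Qed.

End Radical.

(** What the arguments use of the radical of a local algebra; [locR] says that the residue field is
    [k]. *)
Record local_radical J := LocalRadical {
  local_left : left_ideal J;
  loc1 : 1x \notin J;
  locV : forall a, a \notin J -> exists b, b ** a = 1x /\ a ** b = 1x;
  locR : forall a, exists c, a - c *: 1x \in J }.

(** * Nakayama's lemma and freeness over a local algebra *)

Section Local.
Variables (J : {vspace R}) (locJ : local_radical J).
Local Notation d := (\dim {:R}).
Local Notation rad := (radm J).


Lemma loc1B j : j \in J -> 1x - j \notin J.
Proof.
move=> jJ; apply: contra (loc1 locJ) => h.
by rewrite -[1x](subrK j) memvD.
Qed.

Lemma stable_radm M (U : {vspace M x}) : stable (rad U).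
Proof.
move=> a u; rewrite memv_preim; move: u; apply/subvP.
apply: radm_sub => j v jJ vU; rewrite -memv_preim -act_compE memv_radm //.
exact: (local_left locJ).
Qed.

Lemma radmSS M (U W : {vspace M x}) : (U <= W)%VS -> (rad U <= rad W)%VS.
Proof.
by move=> /subvP UW; apply: radm_sub => j u jJ uU; rewrite memv_radm ?UW.
Qed.

(** A largest stable V with W <= V < U contains J U, so J U + W cannot be all of U. *)
Lemma nakayama M (U W : {vspace M x}) :
  stable U -> stable W -> (W <= U)%VS -> (U <= rad U + W)%VS -> (U <= W)%VS.
Proof.
move=> sU sW WU UJW; apply/negPn/negP => nUW.
pose P V := [/\ stable V, (W <= V)%VS, (V <= U)%VS & ~~ (U <= V)%VS].
have PW : P W by split.
have [V [[sV WV VU nUV] maxV]] : exists V, P V /\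
    forall V', P V' -> (\dim V' <= \dim V)%N.
  by apply: (ex_maxmeasure PW) => V [_ _ VU _]; apply: dimvS VU.
have radV : (rad U <= V)%VS.
  apply: radm_sub => j u jJ uU.
  have [uV | uV] := boolP (u \in V); first exact: sV.
  (* This is J u + V. If it contained u, then u = i u + v with i in J, and inverting 1 - i would put
     u into V. So it is proper, and by maximality it equals V. *)
  pose V' := (ev x u @: J + V)%VS.
  have sV' : stable V'.
    move=> a _ /memv_addP[_ /memv_imgP[i iJ ->] [v vV ->]].
    rewrite linearD memv_add ?sV //= evE -act_compE -evE memv_img //.
    exact: (local_left locJ).
  have V'U : (V' <= U)%VS.
    rewrite subv_add VU andbT; apply/subvP => w /memv_imgP[i _ ->].
    by rewrite evE sU.
  have PV' : P V'.
    split=> //; first exact: subv_trans WV (addvSr _ _).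
    apply: contra uV => /subvP/(_ u uU)/memv_addP[_ /memv_imgP[i iJ ->] [v vV]].
    rewrite evE => eu; have [b [bi _]] := locV locJ (loc1B iJ).
    rewrite -[u]act_idE -bi act_compE sV // actDl act_idE.
    by rewrite -scaleN1r actZl scaleN1r {1}eu addrAC subrr add0r.
  have eV : V = V'.
    by apply/eqP; rewrite eqEdim addvSr maxV.
  by rewrite eV -evE; apply: subvP (addvSl _ _) _ (memv_img _ jJ).
case/negP: nUV; apply: subv_trans UJW _; by rewrite subv_add radV.
Qed.

(** The dimension of U / J U, which is the minimal number of generators of U because the residue
    field is [k]. *)
Definition rtop M (U : {vspace M x}) := (\dim U - \dim (rad U))%N.

Lemma dim_rtop M (U : {vspace M x}) :
  stable U -> \dim U = (rtop U + \dim (rad U))%N.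
Proof. by move=> sU; rewrite /rtop subnK // dimvS // radmS. Qed.

(** By Nakayama, a basis of a complement of J U in U generates U. *)
Lemma rtop_gen M (U : {vspace M x}) : stable U ->
  exists e : 'I_(rtop U) -> M x, limg (comb e) = U.
Proof.
move=> sU; have radU := radmS J sU.
have dimC : \dim (U :\: rad U) = rtop U.
  have := dimv_cap_compl U (rad U); rewrite (capv_idPr radU) /rtop => <-.
  by rewrite addKn.
rewrite -dimC; exists (fun i => (vbasis (U :\: rad U))`_i).
set e := fun i => _.
have eU i : e i \in U.
  apply: subvP (diffvSl U (rad U)) _ _.
  by apply/vbasis_mem/mem_nth; rewrite size_tuple.
apply/eqP; rewrite eqEsubv comb_sub //=; apply: nakayama => //.
- exact: stable_comb.
- exact: comb_sub.
have -> : (rad U + limg (comb e) = limg (comb e) + rad U)%VS by rewrite addvC.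
apply: (@subv_trans _ _ ((U :\: rad U) + rad U)%VS).
  by rewrite addv_diff addvSl.
apply: addvS => //; apply/subvP => u uC; rewrite (coord_vbasis uC).
by apply: memv_suml => i _; rewrite memvZ ?memv_comb.
Qed.

Lemma dim_comb_le M n (e : 'I_n -> M x) : (\dim (limg (comb e)) <= n * d)%N.
Proof. by rewrite -dim_ffun_fullv -[X in (_ <= X)%N](limg_ker_dim (comb e)) leq_addl. Qed.

Lemma nakayama_dim M (U : {vspace M x}) : stable U -> (\dim U <= rtop U * d)%N.
Proof. by move=> /rtop_gen[e {1}<-]; apply: dim_comb_le. Qed.

(* Equality in nakayama_dim characterises freeness, since J has codimension 1. *)
Definition sfree M (U : {vspace M x}) := \dim U = (rtop U * d)%N.

(** If the dimensions agree, the surjection onto U from the free module on [rtop U] generators is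
    injective. Conversely, a basis of size n gives dim U = n d, and it remains to see
    [rtop U <= n]. *)
Lemma sfreeP M (U : {vspace M x}) : stable U ->
  sfree U <-> exists n (e : 'I_n -> M x), basis_at U e.
Proof.
move=> sU; split=> [fU | [n [e [ke ie]]]].
  have [e ie] := rtop_gen sU; exists (rtop U), e; split=> //.
  have := limg_ker_dim (comb e) fullv.
  rewrite capfv ie fU dim_ffun_fullv => /eqP.
  by rewrite -[X in _ == X]add0n eqn_add2r dimv_eq0 => /eqP.
have dU : \dim U = (n * d)%N.
  by have := limg_ker_dim (comb e) fullv; rewrite capfv ke ie dimv0 dim_ffun_fullv.
apply/eqP; rewrite eqn_leq nakayama_dim //= dU leq_mul2r; apply/orP; right.
(* Every scalar lies in k + J, so the k-span of the basis together with J U is all of U. *)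
rewrite leq_subLR; pose E := [tuple e i | i < n].
have /dimvS le : (U <= rad U + <<E>>)%VS.
  rewrite -{1}ie; apply: comb_sub.
    move=> a _ /memv_addP[u uU [v vE ->]].
    rewrite linearD rpredD //=.
      by apply: subvP (addvSl _ _) _ _; apply: stable_radm.
    have [c ac] := locR locJ a; rewrite -[a](subrK (c *: 1x)) actDl actZl act_idE.
    apply: memv_add; last exact: memvZ.
    apply: memv_radm ac _; move: v vE; apply/subvP/span_subvP => _ /tnthP[i ->].
    by rewrite tnth_mktuple -ie memv_comb.
  move=> i; apply: subvP (addvSr _ _) _ _; apply: memv_span.
  by apply/tnthP; exists i; rewrite tnth_mktuple.
apply: leq_trans le _; rewrite (leq_trans (dimv_add_leqif _ _)) // leq_add2l.
by rewrite (leq_trans (dim_span _)) // size_tuple.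
Qed.

Lemma sfree_free_at M : sfree (fullv : {vspace M x}) <-> free_at M x.
Proof. by rewrite free_atP; apply: sfreeP; apply: stable_full. Qed.

Lemma sfree0 M : sfree (0 : {vspace M x})%VS.
Proof. by rewrite /sfree /rtop dimv0. Qed.

Lemma sfree_img M N (g : 'Hom(M x, N x)) (U : {vspace M x}) :
  equivariant g -> (U :&: lker g = 0)%VS -> stable U -> sfree (g @: U) <-> sfree U.
Proof.
move=> eg iU sU; rewrite /sfree /rtop -radm_img // !limg_dim_eq //.
apply/eqP; rewrite -subv0 -iU; apply: capvS => //; exact: radmS.
Qed.

(** * Freeness in short exact sequences *)

Section Exact.
Variables (M N : lmodule A) (g : 'Hom(M x, N x)).
Hypothesis eg : equivariant g.
Local Notation K := (lker g).
Local Notation I := (limg g).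
Local Notation V := (fullv : {vspace M x}).

(** Rank-nullity for [g] on V and on J V, whose image is J I. *)
Fact exact_dims :
  [/\ \dim V = (\dim K + \dim I)%N,
     \dim (rad V) = (\dim (rad V :&: K) + \dim (rad I))%N
   & (rad K <= rad V :&: K)%VS].
Proof.
split; first by rewrite -[LHS](limg_ker_dim g) capfv.
  by rewrite -[LHS](limg_ker_dim g) radm_img.
rewrite subv_cap radmSS ?subvf // radmS //; exact: stable_ker.
Qed.

Let sK : stable K. Proof. exact: stable_ker. Qed.
Let sI : stable I. Proof. exact/stable_img/stable_full. Qed.
Let sV : stable V. Proof. exact: stable_full. Qed.

(** Since J K lies in J V and in K, [rtop V <= rtop K + rtop I]; this is the inequality opposite to
    Nakayama's. *)
Lemma sfree_ext : sfree K -> sfree I -> sfree V.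
Proof.
rewrite /sfree => fK fI; apply/eqP; rewrite eqn_leq nakayama_dim //=.
have [dV dr /dimvS rK] := exact_dims.
have tV := dim_rtop sV; have tK := dim_rtop sK; have tI := dim_rtop sI.
by rewrite dV fK fI -mulnDl leq_mul2r; apply/orP; right; lia.
Qed.

(* The defect rtop * d - dim is nonnegative, and it is additive when K is pure
   in V modulo J. *)
Lemma sfree_pure : (rad V :&: K <= rad K)%VS -> sfree V -> sfree K /\ sfree I.
Proof.
rewrite /sfree => /dimvS p fV.
have [dV dr /dimvS rK] := exact_dims.
have tV := dim_rtop sV; have tK := dim_rtop sK; have tI := dim_rtop sI.
have nK := nakayama_dim sK; have nI := nakayama_dim sI.
have E : rtop V = (rtop K + rtop I)%N by lia.
by move: fV; rewrite E mulnDl; lia.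
Qed.

(** Lift a basis of I to V. Then V is K plus the span of the lifts, so J V lies in J K plus that
    span, and an element of K has no component along the lifts because their images are
    independent. *)
Lemma pure_img : sfree I -> (rad V :&: K <= rad K)%VS.
Proof.
move=> /(sfreeP sI)[n [e [/eqP/lker0P inj ie]]].
have lift i : {m | g m = e i}.
  exists (g^-1%VF (e i)); apply: limg_lfunVK.
  by rewrite -ie memv_comb.
pose m i := sval (lift i).
have gm a : g (comb m a) = comb e a.
  rewrite !combE linear_sum /=; apply: eq_bigr => i _.
  by rewrite eg /m; case: (lift i) => ? /= ->.
have mK u : exists a, u - comb m a \in K.
  have /memv_imgP[a _ ga] : g u \in limg (comb e) by rewrite ie memv_img ?memvf.
  by exists a; rewrite memv_ker linearB /= gm ga subrr.
have /subvP sub : (rad V <= rad K + limg (comb m))%VS.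
  apply: radm_sub => j u jJ _; have [a ua] := mK u.
  rewrite -[u](subrK (comb m a)) linearD memv_add ?memv_radm //.
  by apply: stable_comb; rewrite memv_img ?memvf.
apply/subvP => u /memv_capP[/sub/memv_addP[v vK [_ /memv_imgP[a _ ->] ->]]].
have : v \in K by apply: subvP vK; apply: radmS.
rewrite !memv_ker linearD /= => /eqP->; rewrite add0r gm.
by rewrite -[X in _ == X](linear0 (comb e)) (inj_eq inj) => /eqP->; rewrite linear0 addr0.
Qed.

(** The equivariant projection 1 - h g fixes K and maps V into K, hence maps J V into J K. *)
Lemma pure_split (h : 'Hom(N x, M x)) :
  equivariant h -> (g \o h = \1)%VF -> (rad V :&: K <= rad K)%VS.
Proof.
move=> eh gh; pose q := (\1 - (h \o g))%VF.
have qE u : q u = u - h (g u).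
  by rewrite /q add_lfunE opp_lfunE id_lfunE comp_lfunE.
have eq : equivariant q by move=> a u; rewrite !qE eg eh linearB.
apply/subvP => u /memv_capP[uV]; rewrite memv_ker => /eqP gu.
have -> : u = q u by rewrite qE gu linear0 subr0.
apply: (@subvP _ _ (q @: rad V)); last exact: memv_img.
rewrite radm_img // radmSS //; apply/subvP => w /memv_imgP[v _ ->].
rewrite memv_ker qE linearB /=.
by have /lfunP/(_ (g v)) := gh; rewrite comp_lfunE id_lfunE => ->; rewrite subrr.
Qed.

End Exact.

(** Multiplying R by J repeatedly on the left gives a chain that, by Nakayama, descends strictly to
    zero. Any nonzero [s] in its last nonzero term will do, since right multiplication by [j] moves
    each term into the next. *)
Lemma left_socle : exists s : R, s != 0 /\ forall j, j \in J -> s ** j = 0.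
Proof.
pose P := lproj A x.
pose I n : {vspace P x} := iter n (@radm J P) fullv.
have sI n : stable (I n) by case: n => [|n]; [apply: stable_full | apply: stable_radm].
have nil : exists n, I n == 0%VS.
  apply: NNPP => nI; have : forall n, (\dim (I n) + n <= \dim (I 0%N))%N.
    elim=> [|n IHn]; first by rewrite addn0.
    apply: leq_trans IHn; rewrite addnS -addSn leq_add2r.
    have /dimv_leqif_sup/ltn_leqif-> := radmS J (sI n).
    apply/negP => le; apply: nI; exists n; rewrite -subv0.
    apply: nakayama; rewrite ?sub0v ?addv0 //.
    by move=> a u; rewrite memv0 => /eqP->; rewrite linear0 mem0v.
  by move/(_ (\dim (I 0%N)).+1); rewrite addnS ltnNge leq_addl.
have one0 : 1x != 0 by apply: contra (loc1 locJ) => /eqP->; apply: mem0v.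
case: (ex_minnP nil) => -[|n] /eqP In0 minn.
  by have : 1x \in I 0%N := memvf _; rewrite In0 memv0 (negPf one0).
have nz : I n != 0%VS by apply/negP => /minn; rewrite ltnn.
pose s : P x := vpick (I n); exists s; split; first by rewrite vpick0.
move=> j jJ; pose g : 'Hom(P x, P x) := @ev k Ob A P x x j.
have eg : equivariant g by move=> a u; rewrite !evE act_compE.
(* At the start, a j = a (j 1) lies in the stable subspace J R; afterwards right multiplication
   commutes with forming J U. *)
have gI l : (g @: I l <= I l.+1)%VS.
  elim: l => [|l IHl].
    apply/subvP => w /memv_imgP[a _ ->]; rewrite evE; apply: sI.
    by rewrite -[j]compm1; apply: (@memv_radm _ P) => //; apply: memvf.
  by rewrite [I l.+1]/(radm J (I l)) radm_img //; apply: radmSS IHl.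
have := subvP (gI n) _ (memv_img g (memv_pick (I n))).
by rewrite In0 memv0 evE => /eqP.
Qed.

(* With s as in left_socle, s kills J M, while in a free module only J K is
   killed by s. *)
Lemma pure_ker M N (g : 'Hom(M x, N x)) : equivariant g ->
  sfree (lker g) -> (rad fullv :&: lker g <= rad (lker g))%VS.
Proof.
move=> eg /(sfreeP (stable_ker eg))[n [e [/eqP/lker0P inj ie]]].
have [s [s0 sJ]] := left_socle.
have sK a : s ** a = 0 -> a \in J.
  move=> sa; apply/negPn/negP => /(locV locJ)[b [_ ab]].
  by case/negP: s0; rewrite -[s]compm1 -ab compA sa linear0 zero_lfunE.
have srad : (rad fullv <= lker (act M s))%VS.
  by apply: radm_sub => j u jJ _; rewrite memv_ker -act_compE sJ ?act0l.
apply/subvP => u /memv_capP[/(subvP srad)]; rewrite memv_ker => /eqP su.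
rewrite -{1}ie => /memv_imgP[a _ ua]; move: su; rewrite ua comb_act.
rewrite -(linear0 (comb e)) => /inj/ffunP sa; rewrite combE.
apply: memv_suml => i _; apply: memv_radm; last by rewrite -ie memv_comb.
by apply: sK; have := sa i; rewrite !ffunE.
Qed.

End Local.
End LocalAlgebra.

(** * Primitive objects over an algebraically closed field *)

(** The characteristic polynomial has positive degree dim V, hence a root in [k]. This is what makes
    the residue fields equal to [k]. *)
Lemma closed_eigenvector (k : closedFieldType) (V : vectType k) (f : 'End(V)) :
  (fullv : {vspace V}) != 0%VS -> exists c v, v != 0 /\ f v = c *: v.
Proof.
move=> nz; pose e := vbasis {:V}%VS.
have eb : basis_of fullv e by apply: vbasisP.
pose g := passmx.mxof e e f.
have [c] : exists c, root (char_poly g) c.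
  apply/closed_rootP; rewrite size_char_poly eqSS.
  by rewrite dimv_eq0.
rewrite -eigenvalue_root_char => gc.
have : passmx.leigenspace f c != 0%VS.
  by rewrite (passmx.leigenspaceE (e := e)) // passmx.vsof_eq0 ?basis_free.
rewrite -vpick0 => nv; exists c, (vpick (passmx.leigenspace f c)); split=> //.
have := memv_pick (passmx.leigenspace f c).
rewrite memv_ker add_lfunE opp_lfunE scale_lfunE id_lfunE subr_eq0.
by move/eqP.
Qed.

Section PrimitiveObject.
Context {k : closedFieldType} {Ob : Type} {A : lcat k Ob} {x : Ob}.
Local Notation R := (A x x).
Local Notation "a ** b" := (comp A a b) (at level 40, left associativity).
Local Notation "1x" := (idm A x).

Lemma sub_maximal_left_ideal (I : {vspace R}) : left_ideal I -> I != fullv ->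
  exists2 J, maximal_left_ideal J & (I <= J)%VS.
Proof.
move=> lI nI; pose P V := [/\ left_ideal V, (I <= V)%VS & V != fullv].
have PI : P I by split.
have [J [[lJ IJ nJ] maxJ]] : exists J, P J /\ forall J', P J' -> (\dim J' <= \dim J)%N.
  by apply: (ex_maxmeasure PI) => V _; apply: dimvS (subvf V).
exists J => //; split=> // L lL JL; have [->|nL] := eqVneq L fullv; first by right.
left; apply/esym/eqP; rewrite eqEdim JL; apply: maxJ; split=> //.
exact: subv_trans JL.
Qed.

(** The unique maximal left ideal J contains every proper one. For a outside J, R a = R, so right
    multiplication by a is bijective: some b has b a = 1, and cancelling a in a b a = a gives a b =
    1. If c is an eigenvalue of right multiplication by a, then a - c is killed by a nonzero v on
    the left, so it is not invertible and lies in J. *)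
Lemma primitive_local : primitive A x -> exists J : {vspace R},
  local_radical J /\
  forall I : {vspace R}, left_ideal I -> I != fullv -> (I <= J)%VS.
Proof.
case=> J [[lJ nJ _] uJ]; exists J.
have top (I : {vspace R}) : left_ideal I -> I != fullv -> (I <= J)%VS.
  by move=> lI nI; have [L /uJ ->] := sub_maximal_left_ideal lI nI.
split=> //.
have J1 : 1x \notin J.
  apply: contra nJ => J1; rewrite eqEsubv subvf; apply/subvP => a _.
  by rewrite -[a]compm1 lJ.
pose r a : 'End(R) := @ev k Ob A (lproj A x) x x a.
have rE a b : r a b = b ** a by exact: (@evE k Ob A (lproj A x) x x a b).
have JV a : a \notin J -> exists b, b ** a = 1x /\ a ** b = 1x.
  move=> aJ; have ra : limg (r a) = fullv.
    apply/eqP/negPn/negP => /top-le; case/negP: aJ; apply: subvP (le _) _ _.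
      move=> c _ /memv_imgP[b _ ->]; rewrite rE compA -rE.
      exact: memv_img (memvf _).
    by have := memv_img (r a) (memvf 1x); rewrite rE comp1m.
  have kr : lker (r a) == 0%VS.
    have := limg_ker_dim (r a) fullv; rewrite capfv ra -[RHS]add0n => /eqP.
    by rewrite eqn_add2r dimv_eq0.
  have /memv_imgP[b _ ba] : 1x \in limg (r a) by rewrite ra memvf.
  rewrite rE in ba; exists b; split=> //.
  by move/lker0P: kr; apply; rewrite !rE -compA -ba compm1 comp1m.
split=> // a.
have nz : (fullv : {vspace R}) != 0%VS.
  apply: contra J1 => /eqP nz.
  by have := memvf 1x; rewrite nz memv0 => /eqP->; apply: mem0v.
have [c [v [v0 vc]]] := closed_eigenvector (r a) nz.
move: vc; rewrite rE => vc; exists c; apply/negPn/negP => /JV[b [_ acb]]; case/negP: v0.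
rewrite -[v]compm1 -acb compA linearB linearZ /= compm1 vc subrr.
by rewrite linear0 zero_lfunE.
Qed.

End PrimitiveObject.

(** * Submodules, quotients and composition series *)

Section Morphisms.
Context {k : fieldType} {Ob : Type} {A : lcat k Ob}.
Implicit Types M N L Q : lmodule A.

Fact lhom_id_nat M x y (f : A x y) :
  (\1 \o act M f = act M f \o \1)%VF.
Proof. by rewrite comp_lfun1l comp_lfun1r. Qed.

Definition lhom_id M : lhom M M := LHom (@lhom_id_nat M).

Fact lhom_comp_nat L M N (p : lhom M N) (q : lhom L M) x y (f : A x y) :
  ((p y \o q y) \o act L f = act N f \o (p x \o q x))%VF.
Proof. by rewrite -comp_lfunA lhom_nat comp_lfunA lhom_nat comp_lfunA. Qed.

Definition lhom_comp L M N (p : lhom M N) (q : lhom L M) : lhom L N :=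
  LHom (lhom_comp_nat p q).

Lemma lhom_equivariant M N (p : lhom M N) x : equivariant (p x).
Proof. by move=> a m; apply: lhom_natE. Qed.

Fact yoneda_nat M x (m : M x) y z (f : A y z) :
  (ev z m \o act (lproj A x) f = act M f \o ev y m)%VF.
Proof. by apply/lfunP => g; rewrite !comp_lfunE !evE act_compE. Qed.

Definition yoneda M x (m : M x) : lhom (lproj A x) M := LHom (yoneda_nat m).

Lemma yonedaE M x (m : M x) y (f : A x y) : yoneda m y f = act M f m.
Proof. exact: evE. Qed.

Lemma lhom_lproj M x (p : lhom (lproj A x) M) y (f : A x y) :
  p y f = act M f (p x (idm A x)).
Proof. by rewrite -lhom_natE act_lproj compm1. Qed.

Lemma lepiP M N (p : lhom M N) x (n : N x) : lepi p -> exists m, n = p x m.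
Proof.
by move=> ep; have := memvf n; rewrite -(ep x) => /memv_imgP[m _ ->]; exists m.
Qed.

Definition lsub_of M (U : forall x, {vspace M x})
    (sU : forall x y (f : A x y) u, u \in U x -> act M f u \in U y) : lsub M.
Proof.
exists U => x y f; apply/subvP => w /memv_imgP[u uU ->]; exact: sU.
Defined.

Lemma lsubP M (U : lsub M) x y (f : A x y) u : u \in U x -> act M f u \in U y.
Proof. by move=> uU; apply: subvP (lsub_stable U f) _ (memv_img _ uU). Qed.

Lemma lsub_is_stable M (U : lsub M) x : stable (U x).
Proof. by move=> a u; apply: lsubP. Qed.

Definition lfull M : lsub M :=
  lsub_of (fun x y (f : A x y) (u : M x) _ => memvf (act M f u)).

Definition lcomap M N (p : lhom M N) (W : lsub N) : lsub M.
Proof.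
apply: (@lsub_of M (fun x => p x @^-1: W x)%VS) => x y f u.
by rewrite -!memv_preim lhom_natE; apply: lsubP.
Defined.

Definition lmap M N (p : lhom M N) (U : lsub M) : lsub N.
Proof.
apply: (@lsub_of N (fun x => p x @: U x)%VS) => x y f _ /memv_imgP[u uU ->].
by rewrite -lhom_natE memv_img // lsubP.
Defined.

Definition lkernel M N (p : lhom M N) : lsub M.
Proof.
apply: (@lsub_of M (fun x => lker (p x))) => x y f u.
by rewrite !memv_ker lhom_natE => /eqP->; rewrite linear0.
Defined.

Lemma lcomapE M N (p : lhom M N) (W : lsub N) x u :
  (u \in lcomap p W x) = (p x u \in W x).
Proof. by rewrite -memv_preim. Qed.

Fact linc_nat M (U : lsub M) x y (f : A x y) :
  (linfun (@vsval _ _ (U y)) \o act (lsubm U) f =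
   act M f \o linfun (@vsval _ _ (U x)))%VF.
Proof.
apply/lfunP => u; rewrite !comp_lfunE [LHS]lfunE [X in _ = act M f X]lfunE.
exact: lsubm_actE.
Qed.

Definition linc M (U : lsub M) : lhom (lsubm U) M := LHom (@linc_nat M U).

Lemma lincE M (U : lsub M) x (u : subvs_of (U x)) : linc U x u = vsval u.
Proof. by rewrite lfunE. Qed.

Lemma limg_linc M (U : lsub M) x : limg (linc U x) = U x.
Proof.
apply/eqP; rewrite eqEsubv; apply/andP; split; apply/subvP => u.
  by move=> /memv_imgP[v _ ->]; rewrite lincE subvsP.
by move=> uU; have := memv_img (linc U x) (memvf (vsproj (U x) u)); rewrite lincE vsprojK.
Qed.

Lemma lker_linc M (U : lsub M) x : lker (linc U x) = 0%VS.
Proof. by apply/eqP/lker0P => u v; rewrite !lincE => /subvs_inj. Qed.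

(** Compose [q] with a linear section of [p]; the inclusion of kernels makes the result independent
    of the section, and therefore natural. *)
Lemma lfactor M N Q (p : lhom M N) (q : lhom M Q) : lepi p ->
  (forall x, lker (p x) <= lker (q x))%VS ->
  exists h : lhom N Q, forall x, (h x \o p x)%VF = q x.
Proof.
move=> ep pq; pose h x := (q x \o (p x)^-1)%VF.
have hp x m : h x (p x m) = q x m.
  rewrite comp_lfunE; apply/eqP; rewrite -subr_eq0 -linearB -memv_ker.
  apply: (subvP (pq x)); rewrite memv_ker linearB /= limg_lfunVK ?subrr //.
  by rewrite memv_img ?memvf.
have hn x y (f : A x y) : (h y \o act N f = act Q f \o h x)%VF.
  apply/lfunP => n; have [m ->] := lepiP n ep.
  by rewrite [LHS]comp_lfunE [RHS]comp_lfunE -lhom_natE !hp lhom_natE.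
by exists (LHom hn) => x; apply/lfunP => m; rewrite comp_lfunE /= hp.
Qed.

Section Quotient.
Variables (M : lmodule A) (U : lsub M).

(* The quotient by U is carried by the complement of U on which
   1 - projv U projects along U. *)
Definition lquot_retr x : 'End(M x) := (\1 - projv (U x))%VF.

Lemma lquot_retrE x m : lquot_retr x m = m - projv (U x) m.
Proof. by rewrite add_lfunE opp_lfunE id_lfunE. Qed.

Lemma lquot_retr0 x m : (lquot_retr x m == 0) = (m \in U x).
Proof.
rewrite lquot_retrE subr_eq0; apply/eqP/idP => [->|/projv_id-> //].
exact: memv_proj.
Qed.

Definition lquot_fiber x : vectType k := subvs_of (limg (lquot_retr x)).

Definition lquot_pr x : 'Hom(M x, lquot_fiber x) :=
  linfun (vsproj (limg (lquot_retr x)) \o lquot_retr x).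

Definition lquot_in x : 'Hom(lquot_fiber x, M x) := linfun vsval.

Lemma lquot_prE x m : vsval (lquot_pr x m) = lquot_retr x m.
Proof. by rewrite lfunE /= vsprojK ?memv_img ?memvf. Qed.

Lemma lquot_pr0 x m : (lquot_pr x m == 0) = (m \in U x).
Proof. by rewrite -lquot_retr0 -lquot_prE. Qed.

Lemma lquot_prK x c : lquot_pr x (lquot_in x c) = c.
Proof.
have /memv_imgP[m _ cm] := subvsP c.
apply/eqP; rewrite -subr_eq0; apply/eqP/val_inj/eqP.
have cE : lquot_in x c = vsval c by rewrite lfunE.
rewrite /= lquot_prE cE cm !lquot_retrE linearB /= projv_proj subrr subr0.
by rewrite subrr.
Qed.

Lemma lquot_inK x m : m - lquot_in x (lquot_pr x m) \in U x.
Proof. by rewrite -lquot_pr0 linearB /= lquot_prK subrr. Qed.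

Definition lquot_act0 x y (f : A x y) : 'Hom(lquot_fiber x, lquot_fiber y) :=
  (lquot_pr y \o (act M f \o lquot_in x))%VF.

Fact lquot_act0_linear x y : linear (@lquot_act0 x y).
Proof.
move=> c f g; apply/lfunP => u.
by rewrite add_lfunE scale_lfunE !comp_lfunE actDl actZl linearP.
Qed.
HB.instance Definition _ x y :=
  GRing.isSemilinear.Build k _ _ _ (@lquot_act0 x y)
    (GRing.semilinear_linear (@lquot_act0_linear x y)).

Definition lquot_act x y := linfun (@lquot_act0 x y).

Lemma lquot_actE x y (f : A x y) m :
  lquot_act x y f (lquot_pr x m) = lquot_pr y (act M f m).
Proof.
rewrite lfunE /= !comp_lfunE; apply/eqP; rewrite -subr_eq0 -linearB /=.
by rewrite lquot_pr0 -linearB /= lsubP // -memvN opprB lquot_inK.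
Qed.

Fact lquot_act1 x : lquot_act x x (idm A x) = \1%VF.
Proof.
by apply/lfunP => u; rewrite -(lquot_prK u) [LHS]lquot_actE act_idE id_lfunE.
Qed.

Fact lquot_actM x y z (g : A y z) (f : A x y) :
  lquot_act x z (comp A g f) = (lquot_act y z g \o lquot_act x y f)%VF.
Proof.
apply/lfunP => u; rewrite -(lquot_prK u) comp_lfunE.
by rewrite [LHS]lquot_actE act_compE ![in RHS]lquot_actE.
Qed.

Definition lquot : lmodule A := LModule lquot_act1 lquot_actM.

Fact lqproj_nat x y (f : A x y) :
  (lquot_pr y \o act M f = act lquot f \o lquot_pr x)%VF.
Proof. by apply/lfunP => m; rewrite [LHS]comp_lfunE [RHS]comp_lfunE [RHS]lquot_actE. Qed.

Definition lqproj : lhom M lquot := @LHom k Ob A M lquot lquot_pr lqproj_nat.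

Lemma lqproj_epi : lepi lqproj.
Proof.
move=> x; apply/eqP; rewrite eqEsubv subvf; apply/subvP => c _.
by rewrite -[c]lquot_prK memv_img ?memvf.
Qed.

Lemma lqproj_ker x : lker (lqproj x) = U x.
Proof. by apply/vspaceP => m; rewrite memv_ker lquot_pr0. Qed.

End Quotient.

Lemma is_quot_lquot M (V U : lsub M) : exists D, is_quot V U D.
Proof.
exists (lquot (lcomap (linc V) U)), (lqproj (lcomap (linc V) U)).
split=> [|x v]; first exact: lqproj_epi.
by rewrite lqproj_ker -(lincE v); apply: lcomapE.
Qed.

Lemma is_quot_zero M (V U : lsub M) D x : is_quot V U D ->
  (fullv : {vspace D x}) = 0%VS <-> (V x <= U x)%VS.
Proof.
case=> p [ep pk]; split=> [D0|VU].
  apply/subvP => v vV; rewrite -(vsprojK vV) -pk memv_ker -memv0 -D0; exact: memvf.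
apply/eqP; rewrite -subv0; apply/subvP => d _; have [v ->] := lepiP d ep.
by rewrite memv0 -memv_ker pk (subvP VU) ?subvsP.
Qed.

(** Submodules of V / U correspond to submodules between U and V; [W'] is the one belonging to
    [W]. *)
Lemma is_quot_simple M (V U : lsub M) D : lsub_le U V -> ~ lsub_le V U ->
  (forall W : lsub M, lsub_le U W -> lsub_le W V -> lsub_le W U \/ lsub_le V W) ->
  is_quot V U D -> lsimple D.
Proof.
move=> UV nVU maxU qD; split.
  apply: NNPP => no; apply: nVU => x; apply/(is_quot_zero x qD)/eqP.
  by apply/negPn/negP => nz; apply: no; exists x.
case: qD => p [ep pk] W.
pose W' := lmap (linc V) (lcomap p W).
have W'E x (v : subvs_of (V x)) : (vsval v \in W' x) = (p x v \in W x).
  apply/memv_imgP/idP => [[u uW]|vW].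
    by rewrite lincE => /subvs_inj->; move: uW; rewrite lcomapE.
  by exists v; rewrite ?lcomapE ?lincE.
case: (maxU W').
- move=> x; apply/subvP => u uU; have uV := subvP (UV x) _ uU.
  rewrite -(vsprojK uV) W'E.
  have: vsproj (V x) u \in lker (p x) by rewrite pk vsprojK.
  by rewrite memv_ker => /eqP->; apply: mem0v.
- by move=> x; apply/subvP => w /memv_imgP[v _ ->]; rewrite lincE subvsP.
- move=> W'U; left=> x; apply/eqP; rewrite -subv0; apply/subvP => d.
  have [v ->] := lepiP d ep; rewrite -W'E => /(subvP (W'U x)).
  by rewrite -pk memv_ker memv0.
- move=> VW'; right=> x; apply/eqP; rewrite eqEsubv subvf; apply/subvP => d _.
  by have [v ->] := lepiP d ep; rewrite -W'E (subvP (VW' x)) ?subvsP.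
Qed.

End Morphisms.

(** * Chains of submodules and composition series *)

Section Chains.
Context {k : fieldType} {Ob : finType} {A : lcat k Ob}.
Implicit Types M N L Q : lmodule A.

Definition ldim M (U : lsub M) := (\sum_x \dim (U x))%N.

Lemma leq_ldim M (U V : lsub M) : lsub_le U V -> (ldim U <= ldim V)%N.
Proof. by move=> UV; apply: leq_sum => x _; apply: dimvS. Qed.

Lemma ldim_eq M (U V : lsub M) : lsub_le U V -> (ldim V <= ldim U)%N -> lsub_le V U.
Proof.
move=> UV le x; rewrite -(dimv_leqif_sup (UV x)) eqn_leq dimvS //=.
move: le; rewrite /ldim (bigD1 x) //= [leqRHS](bigD1 x) //= => le.
have : (\sum_(y | y != x) \dim (U y) <= \sum_(y | y != x) \dim (V y))%N.
  by apply: leq_sum => y _; apply: dimvS.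
lia.
Qed.

(** Each step strictly lowers the total dimension, so the descent reaches zero, and read upwards it
    is a filtration. It yields both composition series and standard filtrations. *)
Lemma lchain M (X : lmodule A -> Prop) (P : lsub M -> Prop) (U : lsub M) :
  (forall U, P U -> lsub_zero U \/ exists V D,
     [/\ P V, lsub_le V U, ~ lsub_le U V, X D & is_quot U V D]) ->
  P U -> exists n (F : nat -> lsub M),
    [/\ lsub_zero (F 0%N), F n = U, forall i, (i < n)%N -> lsub_le (F i) (F i.+1)
      & forall i, (i < n)%N -> exists2 D, X D & is_quot (F i.+1) (F i) D].
Proof.
move=> step; move: {2}(ldim U).+1 (ltnSn (ldim U)) => b.
elim: b U => // b IHb U Ub PU.
have [U0|[V [D [PV VU nUV XD qD]]]] := step U PU; first by exists 0%N, (fun=> U).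
have Vb : (ldim V < b)%N.
  rewrite ltnNge; apply/negP => bV; apply: nUV; apply: ldim_eq VU _; lia.
have [n [F [F0 Fn Fle Fq]]] := IHb V Vb PV.
exists n.+1, (fun i => if (i <= n)%N then F i else U); split=> //.
- by rewrite ltnn.
- move=> i; rewrite ltnS => le; rewrite le; case: ltngtP le => // [lt|->] _.
    exact: Fle.
  by rewrite Fn.
- move=> i; rewrite ltnS => le; rewrite le; case: ltngtP le => // [lt|->] _.
    exact: Fq.
  by exists D; rewrite ?Fn.
Qed.

(** A proper submodule of largest total dimension has a simple quotient. *)
Lemma composition_series M : filtered_by lsimple M.
Proof.
suff step (U : lsub M) : True -> lsub_zero U \/ exists V D,
    [/\ True, lsub_le V U, ~ lsub_le U V, lsimple D & is_quot U V D].
  have [n [F [F0 Fn Fle Fq]]] := @lchain M lsimple (fun=> True) (lfull M) step I.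
  by exists n, F; split=> //; split=> //; rewrite Fn.
move=> _; have [?|nz] := classic (lsub_zero U); [by left | right].
have z0 x y (f : A x y) u : u \in (0 : {vspace M x})%VS ->
    act M f u \in (0 : {vspace M y})%VS.
  by rewrite !memv0 => /eqP->; rewrite linear0.
pose Z : lsub M := lsub_of z0.
pose P V := lsub_le V U /\ ~ lsub_le U V.
have PZ : P Z.
  split=> [x|UZ]; first exact: sub0v.
  by apply: nz => x; apply/eqP; rewrite -subv0; apply: UZ.
have [V [[VU nUV] maxV]] : exists V, P V /\ forall V', P V' -> (ldim V' <= ldim V)%N.
  by apply: (ex_maxmeasure PZ) => V [/leq_ldim le _]; exact: le.
have [D qD] := is_quot_lquot U V; exists V, D; split=> //.
apply: (is_quot_simple VU nUV) qD => W VW WU.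
have [UW|nUW] := classic (lsub_le U W); [by right | left].
by apply: ldim_eq VW _; apply: maxV.
Qed.

End Chains.

(** * Standard modules of a directed category *)

Section Update.
Context {k : fieldType} {Ob : eqType} {A : lcat k Ob}.
Variables (M : lmodule A) (U : lsub M) (x : Ob) (W : {vspace M x}).

(** The fibre at [x] becomes [W], which must be transported along the equality [x = y] to live in
    [M y]. *)
Definition update_space y : {vspace M y} :=
  if x =P y is ReflectT e then ecast z {vspace M z} e W else U y.

Lemma update_spaceE : update_space x = W.
Proof. by rewrite /update_space; case: eqP => // e; rewrite eq_axiomK. Qed.

Lemma update_spaceN y : y != x -> update_space y = U y.
Proof.
by move=> yx; rewrite /update_space; case: eqP => // xy; rewrite xy eqxx in yx.
Qed.

Lemma update_lsub : stable W -> (W <= U x)%VS ->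
  (forall y (f : A y x) u, y != x -> u \in U y -> act M f u \in W) ->
  exists V : lsub M, V x = W /\ forall y, y != x -> V y = U y.
Proof.
move=> sW WU into.
have sV y z (f : A y z) u : u \in update_space y -> act M f u \in update_space z.
  have [zx|zx] := eqVneq z x; have [yx|yx] := eqVneq y x; subst;
    rewrite ?update_spaceE ?[update_space z]update_spaceN //
            ?[update_space y]update_spaceN //.
  - exact: sW.
  - exact: into.
  - by move/(subvP WU); apply: lsubP.
  - exact: lsubP.
by exists (lsub_of sV); split; [apply: update_spaceE | apply: update_spaceN].
Qed.

End Update.

Section DirectedCategory.
Context {k : closedFieldType} {disp : Order.disp_t} {Ob : finOrderType disp}.
Variable A : lcat k Ob.
Hypothesis A_directed : directed A.
Hypothesis A_primitive : forall x : Ob, primitive A x.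
Implicit Types M N L D S P Q : lmodule A.

Lemma mor_eq0 x y (f : A x y) : ~~ (x <= y)%O -> f = 0.
Proof.
move=> nxy; apply/eqP; rewrite -memv0.
have [<-|nz] := eqVneq (fullv : {vspace A x y}) 0%VS; first exact: memvf.
by case/negP: nxy; apply: A_directed.
Qed.

(** Nonzero factors would give x <= y <= x. *)
Lemma loop_eq0 x y (f : A y x) (g : A x y) : y != x -> comp A f g = 0.
Proof.
move=> yx; have [xy|/(mor_eq0 g)->] := boolP (x <= y)%O; last by rewrite linear0.
rewrite (@mor_eq0 _ _ f) ?linear0 ?zero_lfunE //.
by apply: contra yx => yx; rewrite eq_le xy yx.
Qed.

(* P_x with its fibre at x replaced by a left ideal is a submodule, since a
   path x -> y -> x with y <> x vanishes. *)
Lemma lproj_update x (I : {vspace A x x}) : left_ideal I ->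
  exists V : lsub (lproj A x), V x = I /\ forall y, y != x -> V y = fullv.
Proof.
move=> lI; apply: (@update_lsub _ _ _ _ (lfull (lproj A x)) x I) => //.
- exact: subvf.
- by move=> y f u yx _; rewrite act_lproj loop_eq0 ?mem0v.
Qed.

Lemma lproj_full x (U : lsub (lproj A x)) : idm A x \in U x -> lsub_full U.
Proof.
move=> U1 y; apply/eqP; rewrite eqEsubv subvf; apply/subvP => f _.
by rewrite -[f]compm1 -act_lproj lsubP.
Qed.

(** A nonzero vector of [S y] defines an epimorphism from P_y, whose kernel is a maximal submodule.
    P_y has a largest proper submodule, so this kernel is the radical. *)
Lemma simple_is_top y S : lsimple S -> (fullv : {vspace S y}) != 0%VS ->
  is_top (lproj A y) S.
Proof.
move=> [_ simS] Sy; have [J [locJ topJ]] := primitive_local (A_primitive y).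
pose v := vpick (fullv : {vspace S y}); have v0 : v != 0 by rewrite vpick0.
pose p := yoneda v.
have p1 : p y (idm A y) = v by rewrite yonedaE act_idE.
have ep : lepi p.
  case: (simS (lmap p (lfull _))) => [Z|//].
  have := memv_img (p y) (memvf (idm A y)).
  by rewrite [limg _](Z y) p1 memv0 (negPf v0).
(* [N] is J at [y] and full elsewhere. It contains every proper submodule: such a submodule misses
   the generator 1_y, so its fibre at [y] is a proper left ideal. *)
have [N [Ny Nf]] := lproj_update (local_left locJ).
have nN : ~ lsub_full N.
  by move/(_ y) => Nfull; case/negP: (loc1 locJ); rewrite -Ny Nfull memvf.
have subN (U : lsub (lproj A y)) : ~ lsub_full U -> lsub_le U N.
  move=> nU z; have [->|zy] := eqVneq z y; last by rewrite Nf ?subvf.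
  rewrite Ny; apply: topJ.
    by move=> a b bU; apply: (lsubP (M := lproj A y)).
  by apply/eqP => Uy; apply: nU; apply: lproj_full; rewrite Uy memvf.
have nK : ~ lsub_full (lkernel p).
  move/(_ y)/vspaceP/(_ (idm A y)); rewrite memvf memv_ker p1.
  by rewrite (negPf v0).
exists p; split=> // z f; split=> [fp U [nU maxU]|h].
  have [NU|//] := maxU N (subN U nU).
  exact: subvP (NU z) _ (subvP (subN _ nK z) _ fp).
apply: (h (lkernel p)); split=> // V KV.
have [Z|F] := simS (lmap p V); [left|right] => w.
  apply/subvP => u uV; rewrite memv_ker -memv0 -(Z w); exact: memv_img.
apply/eqP; rewrite eqEsubv subvf; apply/subvP => u _.
have : p w u \in lmap p V w by rewrite F memvf.
case/memv_imgP => u' u'V pu; rewrite -[u](subrK u') memvD //.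
by apply: (subvP (KV w)); rewrite memv_ker linearB /= pu subrr.
Qed.

(** A factor that is the top of P_y is generated by the image of 1_y, so it is nonzero at y, and
    then so is D. *)
Lemma supported_factors_le x D :
  (forall y, y != x -> (fullv : {vspace D y}) = 0%VS) -> factors_le x D.
Proof.
move=> D0 y S [p [ep _]] [n [F [_ simF [i lt qS]]]].
(* [S] is nonzero because the simple [D'] is another model of the same quotient. *)
have [D' [[z nz] _] qD'] := simF i lt.
suff : y == x by move/eqP->.
apply/negPn/negP => /D0 Dy0; case/negP: nz; apply/eqP/(is_quot_zero z qD').
apply/(is_quot_zero z qS)/eqP; rewrite -subv0; apply/subvP => s _.
have [f ->] := lepiP s ep; rewrite lhom_lproj.
suff -> : p y (idm A y) = 0 by rewrite linear0 mem0v.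
apply/eqP; rewrite -memv0.
suff <- : (fullv : {vspace S y}) = 0%VS by apply: memvf.
apply/(is_quot_zero y qS); apply: subv_trans (subvf _) _.
by rewrite Dy0 sub0v.
Qed.

(** As a quotient of P_x, Q lives at objects above x. A composition factor that is nonzero at y is
    the top of P_y, which forces y <= x. *)
Lemma factors_le_supported x Q (q : lhom (lproj A x) Q) y :
  lepi q -> factors_le x Q -> y != x -> (fullv : {vspace Q y}) = 0%VS.
Proof.
move=> eq fQ yx; apply/eqP/negPn/negP => nz.
have xy : (x <= y)%O.
  apply/negPn/negP => nxy; case/negP: nz; rewrite -subv0; apply/subvP => m _.
  by have [f ->] := lepiP m eq; rewrite (mor_eq0 f) // linear0 mem0v.
have [n [F [[F0 Fn Fle] Fq]]] := composition_series Q.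
have [i lt Fi] : exists2 i, (i < n)%N & ~~ (F i.+1 y <= F i y)%VS.
  apply: NNPP => no; case/negP: nz; rewrite -subv0 -(Fn y).
  have : (n <= n)%N by []. elim: {-2}n => [|i IHi] lt; first by rewrite F0.
  apply: subv_trans (IHi (ltnW lt)); apply/negPn/negP => nF; apply: no.
  by exists i.
have [S simS qS] := Fq i lt.
have Sy : (fullv : {vspace S y}) != 0%VS.
  by apply/eqP => /(is_quot_zero y qS); apply/negP.
have yx' : (y <= x)%O.
  by apply: (fQ y S); [apply: simple_is_top | exists n, F; split=> //; exists i].
by case/negP: yx; rewrite eq_le xy yx'.
Qed.

(** Delta_x is P_x with everything away from [x] divided out. Every admissible quotient of P_x is
    concentrated at [x], so it factors through this one. *)
Lemma is_standardP x D : is_standard x D <->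
  [/\ exists m : D x, lepi (yoneda m) /\ lker (yoneda m x) = 0%VS
    & forall y, y != x -> (fullv : {vspace D y}) = 0%VS].
Proof.
split=> [[p [ep fD uD]]|[[m [em km]] D0]]; last first.
  have fD := supported_factors_le D0.
  exists (yoneda m); split=> // Q q eq fQ; apply: lfactor => // y.
  have [->|yx] := eqVneq y x; first by rewrite km sub0v.
  apply/subvP => f _; rewrite memv_ker -memv0.
  by rewrite -(factors_le_supported eq fQ yx) memvf.
split; last by move=> y; apply: factors_le_supported ep fD.
have pE y : yoneda (p x (idm A x)) y = p y.
  by apply/lfunP => f; rewrite yonedaE [RHS]lhom_lproj.
exists (p x (idm A x)); split=> [y|]; first by rewrite pE; apply: ep.
(* With [V] zero at [x] and full elsewhere, P_x / V is admissible, so the universal property puts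
   the kernel of [p] at [x] inside [V x = 0]. *)
rewrite pE; have [|V [Vx Vf]] := @lproj_update x 0%VS.
  by move=> a b; rewrite !memv0 => /eqP->; rewrite linear0.
have [|h hp] := uD (lquot V) (lqproj V) (lqproj_epi V).
  apply: supported_factors_le => y yx; apply/eqP; rewrite -subv0.
  apply/subvP => c _; have [f ->] := lepiP c (lqproj_epi V).
  by rewrite memv0 -memv_ker lqproj_ker Vf ?memvf.
apply/eqP; rewrite -subv0 -Vx -lqproj_ker; apply/subvP => f.
rewrite !memv_ker -[lqproj V x]hp comp_lfunE => /eqP->.
by rewrite linear0.
Qed.

Lemma lproj_loop_free x : free_at (lproj A x) x.
Proof.
pose P := lproj A x; pose e (i : 'I_1) : P x := idm A x.
have cE c : comb e c = c ord0 by rewrite combE big_ord1 act_lproj compm1.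
apply/free_atP; exists 1%N, e; split.
  by apply/eqP/lker0P => c c'; rewrite !cE => cc; apply/ffunP => i; rewrite ord1.
apply/eqP; rewrite eqEsubv subvf; apply/subvP => a _.
by apply/memv_imgP; exists [ffun=> a]; rewrite ?memvf // cE ffunE.
Qed.

Lemma standard_free x D y : is_standard x D -> free_at D y.
Proof.
case/is_standardP => -[m [em km]] D0.
have [J [locJ _]] := primitive_local (A_primitive y).
apply/(sfree_free_at locJ); have [yx|/D0->] := eqVneq y x; last exact: sfree0.
subst y; rewrite -(em x); apply/sfree_img.
- exact: lhom_equivariant.
- by rewrite km capv0.
- exact: stable_full.
- exact/(sfree_free_at locJ)/lproj_loop_free.
Qed.

(** Freeness at [x] climbs the filtration, each term being an extension of a free fibre by the
    previous one. The inclusions [linc] translate between subspaces of [M x] and fibres of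
    submodules. *)
Lemma F_Delta_free M x : F_Delta M -> free_at M x.
Proof.
case=> n [F [[F0 Fn Fle] Fq]].
have [J [locJ _]] := primitive_local (A_primitive x).
apply/(sfree_free_at locJ); rewrite -(Fn x).
have : (n <= n)%N by []. elim: {-2}n => [|i IHi] lt.
  by rewrite F0; apply: sfree0.
have [D [z stD] [p [ep pk]]] := Fq i lt.
have ec := @lhom_equivariant _ _ _ _ _ (linc (F i.+1)) x.
have cap0 (W : {vspace lsubm (F i.+1) x}) : (W :&: lker (linc (F i.+1) x) = 0)%VS.
  by rewrite lker_linc capv0.
rewrite -(limg_linc (F i.+1)); apply/(sfree_img J ec) => //.
  exact: stable_full.
apply: (sfree_ext locJ (@lhom_equivariant _ _ _ _ _ p x)).
  apply/(sfree_img J ec (cap0 _)); first exact/stable_ker/lhom_equivariant.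
  suff -> : (linc (F i.+1) x @: lker (p x))%VS = F i x by apply: IHi; apply: ltnW.
  apply/vspaceP => u; apply/memv_imgP/idP => [[v vp ->]|uF].
    by rewrite lincE -pk.
  have uF' := subvP (Fle i lt x) _ uF.
  exists (vsproj (F i.+1 x) u); last by rewrite lincE vsprojK.
  by rewrite pk vsprojK.
by rewrite ep; apply/sfree_free_at => //; apply: standard_free stD.
Qed.

(** Free fibres, expressed inside [M] so that submodules of a fixed module can be compared. *)
Definition basic M (U : lsub M) :=
  forall y, exists n (e : 'I_n -> M y), basis_at (U y) e.

(* Take x minimal in the support of U: removing one vector from a basis of U x
   leaves a submodule with quotient Delta_x. *)
Lemma standard_quotient M (U : lsub M) : basic U -> ~ lsub_zero U ->
  exists (V : lsub M) D, [/\ basic V, lsub_le V U, ~ lsub_le U V,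
    exists x, is_standard x D & is_quot U V D].
Proof.
move=> bU nzU.
have [x0 x0U] : exists x, U x != 0%VS.
  by apply: NNPP => no; apply: nzU => x; apply/eqP/negPn/negP => nz; apply: no; exists x.
have [x xU minx] : exists2 x, U x != 0%VS & forall y, U y != 0%VS -> (x <= y)%O.
  have := @Order.TotalTheory.arg_minP _ _ _ x0 (fun x => U x != 0%VS) id x0U.
  by case=> x; exists x.
have [n [e [ke ie]]] := bU x.
have eU i : e i \in U x by rewrite -ie memv_comb.
case: n e ke ie eU => [|n] e ke ie eU.
  case/negP: xU; rewrite -subv0 -ie; apply: comb_sub => [a u|[]//].
  by rewrite memv0 => /eqP->; rewrite linear0 mem0v.
have inj : injective (comb e) by apply/lker0P/eqP.
pose e' (i : 'I_n) := e (lift ord0 i).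
have combS a : comb e a = act M (a ord0) (e ord0) + comb e' [ffun i => a (lift ord0 i)].
  rewrite !combE big_ord_recl; congr (_ + _).
  by apply: eq_bigr => i _; rewrite ffunE.
have e'U : (limg (comb e') <= U x)%VS.
  by apply: comb_sub => [|i]; [apply: lsub_is_stable | apply: eU].
(* For [y] other than [x], minimality of [x] means that [U y] is zero or that there is no nonzero
   morphism from [y] to [x]. *)
have [|V [Vx Vf]] := update_lsub (@stable_comb _ _ _ _ _ _ e') e'U.
  move=> y f u yx uU; have [U0|/minx xy] := eqVneq (U y) 0%VS.
    by move: uU; rewrite U0 memv0 => /eqP->; rewrite linear0 mem0v.
  by rewrite (mor_eq0 f) ?act0l ?mem0v //; apply: contra yx => yx; rewrite eq_le xy yx.
have VU : lsub_le V U.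
  by move=> y; have [->|/Vf->] := eqVneq y x; rewrite ?Vx.
have [D qD] := is_quot_lquot U V; exists V, D.
(* Independence of the basis: [b] is the relation with coefficient -a at the dropped vector. *)
have e0 a : act M a (e ord0) \in V x -> a = 0.
  rewrite Vx => /memv_imgP[c _ ac].
  pose b := [ffun i => oapp c (- a) (unlift ord0 i)].
  have : comb e b = comb e 0.
    rewrite combS ffunE unlift_none /= linear0 -scaleN1r actZl scaleN1r ac.
    set c' := [ffun _ => _]; suff -> : c' = c by rewrite addNr.
    by apply/ffunP => i; rewrite !ffunE liftK.
  move/inj/ffunP/(_ ord0); rewrite !ffunE unlift_none /=.
  by move/eqP; rewrite oppr_eq0 => /eqP.
split=> //.
- move=> y; have [->|/Vf->] := eqVneq y x; last exact: bU.
  exists n, e'; split=> //; apply/eqP/lker0P => b c bc.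
  pose ext (f : {ffun 'I_n -> A x x}) : {ffun 'I_n.+1 -> A x x} :=
    [ffun i => oapp f 0 (unlift ord0 i)].
  have extE f : comb e (ext f) = comb e' f.
    rewrite combS ffunE unlift_none /= act0l add0r; congr (comb _ _).
    by apply/ffunP => i; rewrite !ffunE liftK.
  have /inj/ffunP h : comb e (ext b) = comb e (ext c) by rewrite !extE.
  by apply/ffunP => i; have := h (lift ord0 i); rewrite !ffunE liftK.
- move=> /(_ x)/subvP/(_ _ (eU ord0)); rewrite -[e ord0]act_idE => /e0 one0.
  case/negP: xU; rewrite -subv0; apply/subvP => u _.
  by rewrite -[u]act_idE one0 act0l mem0v.
exists x; apply/is_standardP.
have D0 y : y != x -> (fullv : {vspace D y}) = 0%VS.
  by move=> /Vf Vy; apply/(is_quot_zero y qD); rewrite Vy.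
split=> //; case: qD => p [ep pk].
(* The class of the dropped vector generates the quotient freely at [x]. *)
pose v : lsubm U x := vsproj (U x) (e ord0); exists (p x v).
have vE a : vsval (act (lsubm U) a v : lsubm U x) = act M a (e ord0).
  by rewrite [LHS]lsubm_actE vsprojK.
split=> [y|].
  have [->|yx] := eqVneq y x; last first.
    by apply/eqP; rewrite eqEsubv subvf (D0 y yx) sub0v.
  apply/eqP; rewrite eqEsubv subvf; apply/subvP => c _.
  have [u ->] := lepiP c ep.
  have : vsval u \in limg (comb e) by rewrite ie subvsP.
  case/memv_imgP => a _ ua.
  suff -> : p x u = yoneda (p x v) x (a ord0) by rewrite memv_img ?memvf.
  rewrite yonedaE -lhom_natE; apply/eqP; rewrite -subr_eq0 -linearB -memv_ker pk.
  by rewrite linearB /= vE ua combS addrAC subrr add0r Vx memv_img ?memvf.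
apply/eqP; rewrite -subv0; apply/subvP => a.
by rewrite memv_ker yonedaE -lhom_natE -memv_ker pk vE memv0 => /e0->.
Qed.

(** Splitting off a standard quotient leaves free fibres, so it can be repeated down to zero. *)
Lemma free_F_Delta M : (forall x, free_at M x) -> F_Delta M.
Proof.
move=> fM; have step (U : lsub M) : basic U -> lsub_zero U \/ exists V D,
    [/\ basic V, lsub_le V U, ~ lsub_le U V, exists x, is_standard x D & is_quot U V D].
  move=> bU; have [?|nz] := classic (lsub_zero U); [by left | right].
  exact: standard_quotient.
have bM : basic (lfull M) by move=> y; apply/free_atP.
have [n [F [F0 Fn Fle Fq]]] := lchain step bM.
by exists n, F; split=> //; split=> //; rewrite Fn.
Qed.

End DirectedCategory.

(** * Projective modules and resolutions *)

Section DirectSums.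
Context {k : fieldType} {Ob : Type} {A : lcat k Ob}.
Variables M N : lmodule A.

Definition lsum_fst_fun x : 'Hom(lsum M N x, M x) := linfun (@fst (M x) (N x)).
Definition lsum_snd_fun x : 'Hom(lsum M N x, N x) := linfun (@snd (M x) (N x)).

Definition inl0 x (u : M x) : M x * N x := (u, 0).
Definition inr0 x (u : N x) : M x * N x := (0, u).

Fact inl_linear x : linear (@inl0 x).
Proof. by move=> c u v; congr pair; rewrite /= scaler0 addr0. Qed.
HB.instance Definition _ x :=
  GRing.isSemilinear.Build k _ _ _ (@inl0 x)
    (GRing.semilinear_linear (@inl_linear x)).
Fact inr_linear x : linear (@inr0 x).
Proof. by move=> c u v; congr pair; rewrite /= scaler0 addr0. Qed.
HB.instance Definition _ x :=
  GRing.isSemilinear.Build k _ _ _ (@inr0 x)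
    (GRing.semilinear_linear (@inr_linear x)).

Definition lsum_inl_fun x : 'Hom(M x, lsum M N x) :=
  linfun (@inl0 x).
Definition lsum_inr_fun x : 'Hom(N x, lsum M N x) :=
  linfun (@inr0 x).

Lemma lsum_fstE x (u : lsum M N x) : lsum_fst_fun x u = u.1.
Proof. exact: lfunE. Qed.
Lemma lsum_sndE x (u : lsum M N x) : lsum_snd_fun x u = u.2.
Proof. exact: lfunE. Qed.
Lemma lsum_inlE x (u : M x) : lsum_inl_fun x u = (u, 0).
Proof. exact: lfunE. Qed.
Lemma lsum_inrE x (u : N x) : lsum_inr_fun x u = (0, u).
Proof. exact: lfunE. Qed.

Fact lsum_fst_nat x y (f : A x y) :
  (lsum_fst_fun y \o act (lsum M N) f = act M f \o lsum_fst_fun x)%VF.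
Proof.
apply/lfunP => u; rewrite [LHS]comp_lfunE [RHS]comp_lfunE !lsum_fstE.
by rewrite [X in X.1]lsum_actE.
Qed.

Fact lsum_snd_nat x y (f : A x y) :
  (lsum_snd_fun y \o act (lsum M N) f = act N f \o lsum_snd_fun x)%VF.
Proof.
apply/lfunP => u; rewrite [LHS]comp_lfunE [RHS]comp_lfunE !lsum_sndE.
by rewrite [X in X.2]lsum_actE.
Qed.

Fact lsum_inl_nat x y (f : A x y) :
  (lsum_inl_fun y \o act M f = act (lsum M N) f \o lsum_inl_fun x)%VF.
Proof.
apply/lfunP => u; rewrite [LHS]comp_lfunE [RHS]comp_lfunE !lsum_inlE.
by rewrite [RHS]lsum_actE linear0.
Qed.

Fact lsum_inr_nat x y (f : A x y) :
  (lsum_inr_fun y \o act N f = act (lsum M N) f \o lsum_inr_fun x)%VF.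
Proof.
apply/lfunP => u; rewrite [LHS]comp_lfunE [RHS]comp_lfunE !lsum_inrE.
by rewrite [RHS]lsum_actE linear0.
Qed.

Definition lsum_fst := LHom lsum_fst_nat.
Definition lsum_snd := LHom lsum_snd_nat.
Definition lsum_inl := LHom lsum_inl_nat.
Definition lsum_inr := LHom lsum_inr_nat.

Lemma lsum_fstK x : (lsum_fst x \o lsum_inl x)%VF = \1%VF.
Proof. by apply/lfunP => u; rewrite comp_lfunE id_lfunE /= lsum_inlE lsum_fstE. Qed.

Lemma lsum_sndK x : (lsum_snd x \o lsum_inr x)%VF = \1%VF.
Proof. by apply/lfunP => u; rewrite comp_lfunE id_lfunE /= lsum_inrE lsum_sndE. Qed.

Section Copair.
Variables (Q : lmodule A) (p : lhom M Q) (q : lhom N Q).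

Definition lcopair_fun x : 'Hom(lsum M N x, Q x) :=
  ((p x \o lsum_fst x) + (q x \o lsum_snd x))%VF.

Lemma lcopair_funE x (u : lsum M N x) : lcopair_fun x u = p x u.1 + q x u.2.
Proof. by rewrite add_lfunE !comp_lfunE /= lsum_fstE lsum_sndE. Qed.

Fact lcopair_nat x y (f : A x y) :
  (lcopair_fun y \o act (lsum M N) f = act Q f \o lcopair_fun x)%VF.
Proof.
apply/lfunP => u; rewrite [LHS]comp_lfunE [RHS]comp_lfunE !lcopair_funE.
by rewrite (lsum_actE f u) /= !lhom_natE linearD.
Qed.

Definition lcopair : lhom (lsum M N) Q := LHom lcopair_nat.

Lemma lcopairE x (u : lsum M N x) : lcopair x u = p x u.1 + q x u.2.
Proof. exact: lcopair_funE. Qed.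

End Copair.

Lemma limg_lcopair Q (p : lhom M Q) (q : lhom N Q) x :
  limg (lcopair p q x) = (limg (p x) + limg (q x))%VS.
Proof.
apply/eqP; rewrite eqEsubv subv_add; apply/and3P; split; apply/subvP => w.
- move=> /memv_imgP[u _ ->]; rewrite lcopairE memv_add ?memv_img ?memvf //.
- move=> /memv_imgP[u _ ->]; apply/memv_imgP; exists ((u, 0) : lsum M N x).
    exact: memvf.
  by rewrite lcopairE /= linear0 addr0.
- move=> /memv_imgP[u _ ->]; apply/memv_imgP; exists ((0, u) : lsum M N x).
    exact: memvf.
  by rewrite lcopairE /= linear0 add0r.
Qed.

Lemma lsum_dim x :
  \dim {:lsum M N x} = (\dim {:M x} + \dim {:N x})%N.
Proof. by rewrite !dimvf. Qed.

Lemma lprojective_lsum : lprojective M -> lprojective N -> lprojective (lsum M N).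
Proof.
move=> pM pN Q Q' p f ep.
have [g1 h1] := pM _ _ p (lhom_comp f lsum_inl) ep.
have [g2 h2] := pN _ _ p (lhom_comp f lsum_inr) ep.
exists (lcopair g1 g2) => x; apply/lfunP => u; rewrite comp_lfunE lcopairE linearD /=.
have := congr1 (fun h : 'Hom(M x, Q' x) => h u.1) (h1 x).
have := congr1 (fun h : 'Hom(N x, Q' x) => h u.2) (h2 x).
rewrite /= !comp_lfunE => -> ->; rewrite -linearD /=.
rewrite lsum_inlE lsum_inrE; congr (f x _); case: u => u v.
by congr pair; rewrite /= ?addr0 ?add0r.
Qed.

End DirectSums.

Section Projectives.
Context {k : fieldType} {Ob : Type} {A : lcat k Ob}.
Implicit Types M N P Q : lmodule A.

Lemma lzero_fullv x : (fullv : {vspace @lzero k Ob A x}) = 0%VS.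
Proof.
by apply/eqP; rewrite -subv0; apply/subvP => u _; rewrite memv0 [u]thinmx0.
Qed.

Fact lhom0_nat M N x y (f : A x y) :
  ((0 : 'Hom(M y, N y)) \o act M f = act N f \o (0 : 'Hom(M x, N x)))%VF.
Proof. by rewrite comp_lfun0l comp_lfun0r. Qed.

Definition lhom0 M N : lhom M N := LHom (@lhom0_nat M N).

Lemma lprojective_zero P : (forall x, (fullv : {vspace P x}) = 0%VS) -> lprojective P.
Proof.
move=> P0 M N p f _; exists (lhom0 P M) => x; apply/lfunP => u.
have : u \in 0%VS by rewrite -P0 memvf.
by rewrite memv0 => /eqP->; rewrite !linear0.
Qed.

(** By Yoneda it suffices to lift the image of 1_x. *)
Lemma lprojective_lproj x : lprojective (lproj A x).
Proof.
move=> M N p f ep; have [m fm] := lepiP (f x (idm A x)) ep.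
exists (yoneda m) => y; apply/lfunP => g.
by rewrite comp_lfunE yonedaE lhom_natE -fm [RHS]lhom_lproj.
Qed.

Definition retract N M :=
  exists (i : lhom N M) (r : lhom M N), forall x, (r x \o i x)%VF = \1%VF.

Lemma retract_trans L M N : retract L M -> retract M N -> retract L N.
Proof.
move=> [i [r ri]] [j [s sj]]; exists (lhom_comp j i), (lhom_comp r s) => x /=.
by rewrite -comp_lfunA (comp_lfunA (s x)) sj comp_lfun1l ri.
Qed.

Lemma lprojective_retract P M (g : lhom M P) : lepi g -> lprojective P -> retract P M.
Proof.
move=> eg pP; have [i gi] := pP _ _ g (lhom_id P) eg.
by exists i, g.
Qed.

Lemma finite_projdim0 M : (forall x, (fullv : {vspace M x}) = 0%VS) -> finite_projdim M.
Proof.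
move=> M0; pose Z := @lzero k Ob A.
have im0 N x : limg (lhom0 N Z x) = 0%VS.
  by apply/eqP; rewrite -subv0 -(lzero_fullv x) subvf.
exists 0%N, (fun=> Z), (fun=> lhom0 Z Z), (lhom0 Z M); split.
- by move=> _; apply/lprojective_zero/lzero_fullv.
- by move=> i _ x; apply: lzero_fullv.
- by move=> x; apply/eqP; rewrite eqEsubv subvf M0 sub0v.
- by move=> x; rewrite im0; apply/esym/eqP; rewrite -subv0 -(lzero_fullv x) subvf.
- by move=> i x; rewrite im0; apply/esym/eqP; rewrite -subv0 -(lzero_fullv x) subvf.
Qed.

(** A resolution of the kernel is spliced with [g]: degrees shift by one, and the new differential
    in degree 0 is the augmentation followed by the inclusion of the kernel. *)
Lemma finite_projdim_cover P M (g : lhom P M) : lprojective P -> lepi g ->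
  finite_projdim (lsubm (lkernel g)) -> finite_projdim M.
Proof.
move=> pP eg [n [Q [d [e [pQ Q0 ee ex0 ex]]]]].
pose Q' i := if i is j.+1 then Q j else P.
pose d' i : lhom (Q' i.+1) (Q' i) :=
  match i return lhom (Q' i.+1) (Q' i) with
  | 0%N => lhom_comp (linc (lkernel g)) e
  | j.+1 => d j
  end.
exists n.+1, Q', d', g; split=> //.
- by case.
- by case.
- by move=> x /=; rewrite limg_comp ee; exact: (limg_linc (lkernel g)).
case=> [|i]; last exact: ex.
move=> x; rewrite [LHS]ex0; apply/vspaceP => u.
rewrite !memv_ker; have -> // : d' 0%N x u = vsval (e x u).
by rewrite [LHS]comp_lfunE; apply: lincE.
Qed.

End Projectives.

(** * Free fibres under retracts, sums, cokernels, kernels and resolutions *)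

Section FreeFibres.
Context {k : closedFieldType} {Ob : Type} {A : lcat k Ob} {x : Ob}.
Hypothesis x_primitive : primitive A x.
Implicit Types L M N P Q : lmodule A.

(** A split epimorphism has a kernel that is pure modulo J, so its image inherits freeness. *)
Lemma retract_free N M : retract N M -> free_at M x -> free_at N x.
Proof.
have [J [locJ _]] := primitive_local x_primitive.
move=> [i [r ri]] /(sfree_free_at locJ) fM; apply/(sfree_free_at locJ).
have er := @lhom_equivariant _ _ _ _ _ r x.
have ei := @lhom_equivariant _ _ _ _ _ i x.
have [_] := sfree_pure locJ er (pure_split J er ei (ri x)) fM.
suff -> : limg (r x) = fullv by [].
apply/eqP; rewrite eqEsubv subvf; apply/subvP => n _.
have /lfunP/(_ n) := ri x; rewrite comp_lfunE id_lfunE => <-.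
exact: memv_img (memvf _).
Qed.

Lemma lsum_free M N : free_at M x -> free_at N x -> free_at (lsum M N) x.
Proof.
have [J [locJ _]] := primitive_local x_primitive.
move=> /(sfree_free_at locJ) fM /(sfree_free_at locJ) fN.
apply/(sfree_free_at locJ).
apply: (sfree_ext locJ (@lhom_equivariant _ _ _ _ _ (lsum_snd M N) x)).
  have -> : lker (lsum_snd M N x) = limg (lsum_inl M N x).
    apply/vspaceP => -[u v]; rewrite memv_ker lsum_sndE /=.
    apply/eqP/memv_imgP => [->|[w _]]; last by rewrite lsum_inlE => -[].
    by exists u; rewrite ?memvf ?lsum_inlE.
  apply/sfree_img => //; first exact: lhom_equivariant.
    rewrite capfv; apply/eqP/lker0P => u v.
    by rewrite !lsum_inlE => -[].
  exact: stable_full.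
suff -> : limg (lsum_snd M N x) = fullv by [].
apply/eqP; rewrite eqEsubv subvf; apply/subvP => v _.
apply/memv_imgP; exists ((0, v) : lsum M N x); rewrite ?memvf //.
by rewrite lsum_sndE.
Qed.

Lemma zero_free M : (fullv : {vspace M x}) = 0%VS -> free_at M x.
Proof.
have [J [locJ _]] := primitive_local x_primitive.
by move=> M0; apply/(sfree_free_at locJ); rewrite M0; apply: sfree0.
Qed.

(** The kernel of [g] is a copy of [L], hence free, and a free kernel is pure modulo J. *)
Lemma cokernel_free L M N (f : lhom L M) (g : lhom M N) :
  lmono f -> lexact f g -> lepi g -> free_at L x -> free_at M x -> free_at N x.
Proof.
have [J [locJ _]] := primitive_local x_primitive.
move=> mf fg eg /(sfree_free_at locJ) fL /(sfree_free_at locJ) fM.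
have eqg := @lhom_equivariant _ _ _ _ _ g x.
have fK : sfree J (lker (g x)).
  rewrite -fg; apply/sfree_img => //; first exact: lhom_equivariant.
    by rewrite mf capv0.
  exact: stable_full.
apply/(sfree_free_at locJ); rewrite -(eg x).
by have [_] := sfree_pure locJ eqg (pure_ker locJ eqg fK) fM.
Qed.

(** Here purity of the kernel comes from freeness of the image. *)
Lemma kernel_free M N (g : lhom M N) :
  lepi g -> free_at M x -> free_at N x -> free_at (lsubm (lkernel g)) x.
Proof.
have [J [locJ _]] := primitive_local x_primitive.
move=> eg /(sfree_free_at locJ) fM /(sfree_free_at locJ) fN.
have eqg := @lhom_equivariant _ _ _ _ _ g x.
rewrite -(eg x) in fN.
have [fK _] := sfree_pure locJ eqg (pure_img locJ eqg fN) fM.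
apply/(sfree_free_at locJ).
have eqi := @lhom_equivariant _ _ _ _ _ (linc (lkernel g)) x.
apply/(sfree_img J eqi); last 2 first.
- exact: stable_full.
- by rewrite limg_linc.
by rewrite lker_linc capv0.
Qed.

(** By exactness each kernel is the image of the preceding differential, so freeness of images
    passes along the resolution from its zero end to [M]. *)
Lemma finite_projdim_free M : (forall P, lprojective P -> free_at P x) ->
  finite_projdim M -> free_at M x.
Proof.
have [J [locJ _]] := primitive_local x_primitive.
move=> fP [n [Q [d [e [pQ Q0 ee ex0 ex]]]]].
have fQ i : sfree J (fullv : {vspace Q i x}) by apply/(sfree_free_at locJ)/fP.
have step N N' (g : lhom N N') : sfree J (fullv : {vspace N x}) ->
    sfree J (lker (g x)) -> sfree J (limg (g x)).
  move=> fN fK; have eqg := @lhom_equivariant _ _ _ _ _ g x.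
  by have [_] := sfree_pure locJ eqg (pure_ker locJ eqg fK) fN.
(* For [j = 0] the differential [d i] starts in degree i + 1 > n, where the resolution is zero. *)
have fd j : forall i, (n <= i + j)%N -> sfree J (limg (d i x)).
  elim: j => [|j IHj] i; last first.
    by rewrite addnS -addSn => le; apply: step => //; rewrite -ex; apply: IHj.
  rewrite addn0 => le; suff -> : limg (d i x) = 0%VS by apply: sfree0.
  by rewrite Q0 ?limg0.
apply/(sfree_free_at locJ); rewrite -(ee x); apply: step => //.
by rewrite -ex0; apply: (fd n).
Qed.

End FreeFibres.

(** * Projectives mapping onto prescribed elements *)

Section Covers.
Context {k : closedFieldType} {Ob : eqType} {A : lcat k Ob}.
Hypothesis A_primitive : forall x : Ob, primitive A x.
Implicit Types M N P Q : lmodule A.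

(** [P] is a direct sum of representables, one for each listed element, and [g] sends generators to
    these elements; no minimality is intended. The dimension formula serves to control the kernel
    later. *)
Lemma projective_cover_of M (s : seq {y : Ob & M y}) :
  exists P (g : lhom P M), [/\ lprojective P,
    forall x, (forall y, free_at (lproj A y) x) -> free_at P x,
    forall t, t \in s -> tagged t \in limg (g (tag t))
  & forall x, \dim {:P x} = (\sum_(t <- s) \dim {:A (tag t) x})%N].
Proof.
elim: s => [|[y m] s [P [g [pP fP gP dP]]]].
  have Z0 := @lzero_fullv k Ob A.
  exists lzero, (lhom0 lzero M); split=> //.
  - exact: lprojective_zero.
  - by move=> x _; apply: zero_free.
  - by move=> x; rewrite Z0 dimv0 big_nil.
exists (lsum (lproj A y) P), (lcopair (yoneda m) g); split.
- by apply: lprojective_lsum => //; apply: lprojective_lproj.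
- by move=> x fx; apply: lsum_free => //; apply: fP.
- move=> t; rewrite inE limg_lcopair => /orP[/eqP->|/gP tg]; last first.
    exact: subvP (addvSr _ _) _ tg.
  apply: subvP (addvSl _ _) _ _; apply/memv_imgP; exists (idm A y).
    exact: memvf.
  by rewrite yonedaE act_idE.
- by move=> x; rewrite lsum_dim dP big_cons.
Qed.

End Covers.

(** * Projective dimension and free fibres in the stratified case *)

Section Main.
Context {k : closedFieldType} {disp : Order.disp_t} {Ob : finOrderType disp}.
Variable A : lcat k Ob.
Hypothesis A_directed : directed A.
Hypothesis A_primitive : forall x : Ob, primitive A x.
Hypothesis A_stratified : standardly_stratified A.
Implicit Types L M N P Q : lmodule A.

Lemma lproj_retract_sum x (s : seq Ob) : x \in s ->
  retract (lproj A x) (\big[@lsum k Ob A/lzero]_(y <- s) lproj A y).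
Proof.
elim: s => // y s IHs; rewrite inE big_cons => /orP[/eqP<-|/IHs xs].
  by exists (lsum_inl _ _), (lsum_fst _ _) => z; apply: lsum_fstK.
apply: retract_trans xs _.
by exists (lsum_inr _ _), (lsum_snd _ _) => z; apply: lsum_sndK.
Qed.

(** P_x is a summand of the regular module, which has free fibres by stratification. *)
Lemma lproj_free x y : free_at (lproj A x) y.
Proof.
apply: (retract_free (A_primitive y)).
  exact: (lproj_retract_sum (mem_index_enum x)).
exact: (F_Delta_free A_directed A_primitive).
Qed.

Lemma sub_vbasis (V : vectType k) (U : {vspace V}) :
  (forall b, b \in vbasis {:V} -> b \in U) -> U = fullv.
Proof.
move=> bU; apply/eqP; rewrite eqEsubv subvf -(span_basis (vbasisP fullv)).
exact/span_subvP.
Qed.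

(** With bases of all fibres as generators, [P] becomes a retract of a sum of representables. *)
Lemma lprojective_free P x : lprojective P -> free_at P x.
Proof.
move=> pP; pose s := [seq Tagged (fun y => P y) b | y <- enum Ob, b <- vbasis {:P y}].
have [Q [g [_ fQ gQ _]]] := projective_cover_of A_primitive s.
apply: (retract_free (A_primitive x) (lprojective_retract _ pP)); last first.
  by apply: fQ => y; apply: lproj_free.
move=> y; apply: sub_vbasis => b bP.
apply: (gQ (Tagged (fun y => P y) b)).
by apply: allpairs_f_dep; rewrite ?mem_enum.
Qed.

(* Take the generators at x from a basis and all others above x: then P x and
   M x have the same dimension, and P y = 0 unless x <= y. *)
Lemma free_cover M x : free_at M x ->
  (forall y, (fullv : {vspace M y}) != 0%VS -> (x <= y)%O) ->
  exists P (g : lhom P M), [/\ lprojective P, forall y, free_at P y, lepi g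
    & forall y, lker (g y) != 0%VS -> (x < y)%O].
Proof.
move=> /free_atP[n [e [ke ie]]] minx; pose T := {y : Ob & M y}.
pose s1 : seq T := [seq Tagged (fun y => M y) (e i) | i <- enum 'I_n].
pose s2 : seq T :=
  [seq Tagged (fun y => M y) b | y <- [seq y <- enum Ob | (x < y)%O], b <- vbasis {:M y}].
have [P [g [pP fP gP dP]]] := projective_cover_of A_primitive (s1 ++ s2).
have eg : lepi g.
  move=> y; have [->|yx] := eqVneq y x.
    apply/eqP; rewrite eqEsubv subvf -ie; apply: comb_sub => [|i].
      exact/stable_img/stable_full/lhom_equivariant.
    apply: (gP (Tagged (fun y => M y) (e i))); rewrite mem_cat.
    by apply/orP; left; apply: map_f; rewrite mem_enum.
  have [M0|/minx xy] := eqVneq (fullv : {vspace M y}) 0%VS.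
    by apply/eqP; rewrite eqEsubv subvf M0 sub0v.
  apply: sub_vbasis => b bM; apply: (gP (Tagged (fun y => M y) b)).
  rewrite mem_cat; apply/orP; right; apply: allpairs_f_dep => //.
  by rewrite mem_filter mem_enum lt_neqAle eq_sym yx xy.
exists P, g; split=> //; first by move=> y; apply: fP => z; apply: lproj_free.
move=> y; apply: contraR => nxy.
(* When [y] is not strictly above [x], only the [n] generators at [x] contribute to [P y]. *)
have A0 z : (x < z)%O -> \dim {:A z y} = 0%N.
  move=> xz; apply/eqP; rewrite dimv_eq0; apply: contraR nxy => /A_directed zy.
  exact: lt_le_trans xz zy.
have d2 : (\sum_(t <- s2) \dim {:A (tag t) y} = 0)%N.
  apply: big1_seq => t /= /allpairsPdep[z [b [zs _ ->]]].
  by apply: A0; move: zs; rewrite mem_filter => /andP[].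
have dPy : \dim {:P y} = (n * \dim {:A x y})%N.
  by rewrite dP big_cat /= d2 addn0 big_map /= big_enum /= sum_nat_const card_ord.
rewrite -dimv_eq0; have := limg_ker_dim (g y) fullv; rewrite capfv eg dPy.
(* At [x] source and target of [g] have equal dimension, so it is injective there; at any other such
   [y] there is no nonzero morphism from [x], and [P y] is zero. *)
have [->|yx] := eqVneq y x.
  have := limg_ker_dim (comb e) fullv.
  rewrite capfv ke ie dimv0 dim_ffun_fullv add0n => <-.
  by move/eqP; rewrite -[X in _ == X]add0n eqn_add2r.
have -> : \dim {:A x y} = 0%N.
  apply/eqP; rewrite dimv_eq0; apply: contraR nxy => /A_directed xy.
  by rewrite lt_neqAle eq_sym yx.
by rewrite muln0 => /eqP; rewrite addn_eq0 => /andP[].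
Qed.

(** Induction on a bound for [c], the number of objects at or above a point of the support. It is at
    least 1 because [y] counts itself, so the bound 0 forces the zero module. *)
Lemma free_finite_projdim M : (forall x, free_at M x) -> finite_projdim M.
Proof.
pose c (y : Ob) := #|[set z | (y <= z)%O]|.
suff main n : forall M, (forall x, free_at M x) ->
    (forall y, (fullv : {vspace M y}) != 0%VS -> (c y <= n)%N) -> finite_projdim M.
  by move=> fM; apply: (main #|Ob|) => // y _; apply: max_card.
elim: n => [|n IHn] {}M fM cM.
  apply: finite_projdim0 => y; apply/eqP/negPn/negP => /cM.
  by rewrite leqn0 cards_eq0 => /eqP/setP/(_ y); rewrite !inE lexx.
have [[x0 nz]|no] := classic (exists x, (fullv : {vspace M x}) != 0%VS); last first.
  by apply: finite_projdim0 => y; apply/eqP/negPn/negP => nz; apply: no; exists y.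
have [x Mx minx] : exists2 x, (fullv : {vspace M x}) != 0%VS
    & forall y, (fullv : {vspace M y}) != 0%VS -> (x <= y)%O.
  have := @Order.TotalTheory.arg_minP _ _ _ x0
    (fun x => (fullv : {vspace M x}) != 0%VS) id nz.
  by case=> x; exists x.
have [P [g [pP fP eg kg]]] := free_cover (fM x) minx.
apply: (finite_projdim_cover pP eg); apply: IHn => [y|y nz'].
  exact: (kernel_free (A_primitive y) eg (fP y) (fM y)).
have xy : (x < y)%O.
  apply: kg; apply: contra nz' => /eqP k0.
  rewrite -dimv_eq0; have := limg_ker_dim (linc (lkernel g) y) fullv.
  rewrite capfv lker_linc dimv0 limg_linc [lkernel g y]k0 dimv0 => <-; exact: eqxx.
(* The bound drops because [x] is counted by [c x] but not by [c y] for [y] strictly above [x]. *)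
rewrite -ltnS; apply: leq_trans (cM x Mx); apply: proper_card; apply/properP; split.
  by apply/subsetP => z; rewrite !inE; apply: le_trans (ltW xy).
by exists x; rewrite !inE // -ltNge.
Qed.

Lemma finite_projdimP M : finite_projdim M <-> forall x, free_at M x.
Proof.
split=> [pM x|]; last exact: free_finite_projdim.
by apply: finite_projdim_free pM => // P; apply: lprojective_free.
Qed.

Lemma F_DeltaP M : F_Delta M <-> forall x, free_at M x.
Proof.
split=> [FM x|]; last exact: free_F_Delta.
exact: F_Delta_free FM.
Qed.

End Main.

Theorem proposition3p4 (k : closedFieldType) (disp : Order.disp_t)
    (Ob : finOrderType disp) (A : lcat k Ob)
    (A_directed : directed A) (A_connected : connected A)
    (A_primitive : forall x : Ob, primitive A x)
    (A_stratified : standardly_stratified A) :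
  [/\ closed_under_cokernels (F_Delta (A := A)),
      forall M : lmodule A, F_Delta M <-> finite_projdim M
    & forall M : lmodule A, finite_projdim M <-> forall x : Ob, free_at M x].
Proof.
split=> [L M N f g mf fg eg /F_DeltaP fL /F_DeltaP fM|M|M].
- by apply/F_DeltaP => // x; apply: cokernel_free mf fg eg _ _; auto.
- by rewrite F_DeltaP // finite_projdimP.
- exact: finite_projdimP.
Qed.
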